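(* Let $f_0:\mathbb{C}\to\hat{\mathbb{C}}$ be a transcendental meromorphic function of finite order $\rho>0$ satisfying: (KU1) $\infty$ is not an asymptotic value of $f_0$; (KU2) there exist a co-finite subset $\mathcal{P}^*$ of the set $\mathcal{P}$ of poles and $R^*>0$ with $\mathrm{dist}(\mathrm{Sing}(f_0^{-1}),a)>2R^*$ for all $a\in\mathcal{P}^*$; (KU3) there is $R^\dagger>0$ with $B(a_1,R^\dagger)\cap B(a_2,R^\dagger)=\emptyset$ for distinct poles; (KU4) there exist $M\in\mathbb{N}$, $\beta\geq0$ such that for each $a\in\mathcal{P}^*$, $1\leq m(a)\leq M$ and $|f_0(z)|\asymp|a|^{-\beta}|z-a|^{-m(a)}$, $|f_0'(z)|\asymp m(a)|a|^{-\beta}|z-a|^{-m(a)-1}$ for $z\in B(a,R^\dagger)$. Then there is $\varepsilon>0$ such that for every sequence $(c_n)$ in $\mathbb{C}$ with $|c_n|<\varepsilon$ for all $n$, $$\mathrm{HD}(I_\infty(F_+))\geq\frac{\rho M^*}{\beta+M^*+1}.$$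
   Context: $m(a)$ is pole multiplicity; $\mathrm{Sing}(f^{-1})$ the finite critical and asymptotic values; $A\asymp B$ means $C^{-1}A\leq B\leq CA$, $C\geq1$ independent of $a,z$. $M^*$ is the largest integer $1\leq M^*\leq M$ such that $\sum_{a\in\mathcal{P},m(a)=M^*}|a|^{-t}$ converges for $t>\rho$ and diverges for $t<\rho$. $f_n=f_0+c_n$, $F_+^n=f_n\circ\dots\circ f_1$; $\mathcal{J}(F_+)$ is the complement of the set of points with a neighborhood where all $F_+^n$ are defined and normal; $I_\infty(F_+)=\{z\in\mathcal{J}(F_+):F_+^n(z)\to\infty\}$. *)

(* Defs.v *)
From Stdlib Require Import Reals Lra List ClassicalDescription.
From Coquelicot Require Import Coquelicot.
Open Scope R_scope.

(* Riemann sphere: Chat = C ∪ {∞}, with None = ∞.                      *)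
Definition Chat := option C.

Definition fin (f : C -> Chat) (z : C) : C :=
  match f z with Some w => w | None => RtoC 0 end.

Definition cderiv (g : C -> C) (z d : C) : Prop :=
  @is_derive C_AbsRing C_NormedModule g z d.

Definition is_pole (f : C -> Chat) (a : C) : Prop := f a = None.

Definition pole_mult (f : C -> Chat) (a : C) (m : nat) : Prop :=
  is_pole f a /\ (1 <= m)%nat /\
  exists L : C, L <> RtoC 0 /\
    forall eps, 0 < eps -> exists del, 0 < del /\
      forall z, 0 < Cmod (Cminus z a) < del ->
        f z <> None /\
        Cmod (Cminus (Cmult (@pow_n C_Ring (Cminus z a) m) (fin f z)) L) < eps.

Definition meromorphic (f : C -> Chat) : Prop :=
  (forall z, exists r, 0 < r /\
     forall w, Cmod (Cminus w z) < r -> w <> z -> f w <> None) /\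
  (forall z, f z <> None -> exists d, cderiv (fin f) z d) /\
  (forall a, is_pole f a -> exists m, pole_mult f a m).

Definition polyval (n : nat) (a : nat -> C) (z : C) : C :=
  sum_n (fun k => Cmult (a k) (@pow_n C_Ring z k)) n.

Definition rational (f : C -> Chat) : Prop :=
  exists (n : nat) (p q : nat -> C),
    (exists k, (k <= n)%nat /\ q k <> RtoC 0) /\
    forall z, polyval n q z <> RtoC 0 ->
      f z = Some (Cdiv (polyval n p z) (polyval n q z)).

Definition transcendental_meromorphic (f : C -> Chat) : Prop :=
  meromorphic f /\ ~ rational f.

Definition logp (x : R) : R := Rmax 0 (ln x).

Definition prox (f : C -> Chat) (r : R) : R :=
  Rinv (2 * PI) *
  RInt (fun th : R => logp (Cmod (fin f (pair (r * cos th) (r * sin th))))) 0 (2 * PI).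

(* n(t,f): number of poles in |z| <= t, counted with multiplicity *)
Definition npoles (f : C -> Chat) (t : R) : R :=
  real (Lub_Rbar (fun x => exists l : list (prod C nat),
     NoDup (map fst l) /\
     List.Forall (fun p => Cmod (fst p) <= t /\ pole_mult f (fst p) (snd p)) l /\
     x = INR (list_sum (map snd l)))).

Definition Ncount (f : C -> Chat) (r : R) : R :=
  RInt (fun t => (npoles f t - npoles f 0) / t) 0 r + npoles f 0 * ln r.

Definition charT (f : C -> Chat) (r : R) : R := prox f r + Ncount f r.

(* rho = limsup_{r -> oo} log T(r,f) / log r.  The limsup is taken over
   radii r not equal to the modulus of a pole (a discrete set of radii),
   where the Riemann integral in m(r,f) is proper; since T(r,f) is
   continuous in r this does not change the limsup. *)
Definition good_radius (f : C -> Chat) (r : R) : Prop :=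
  forall a, is_pole f a -> Cmod a <> r.

Definition has_order (f : C -> Chat) (rho : R) : Prop :=
  (forall eps, 0 < eps -> exists R0, forall r, R0 < r -> good_radius f r ->
      ln (charT f r) / ln r < rho + eps) /\
  (forall eps, 0 < eps -> forall R0, exists r, R0 < r /\ good_radius f r /\
      rho - eps < ln (charT f r) / ln r).

Definition curve_to_inf (g : R -> C) : Prop :=
  (forall t, 0 <= t -> forall eps, 0 < eps -> exists del, 0 < del /\
     forall s, 0 <= s -> Rabs (s - t) < del -> Cmod (Cminus (g s) (g t)) < eps) /\
  (forall K, exists T, forall t, T <= t -> K < Cmod (g t)).

Definition asymptotic_value_inf (f : C -> Chat) : Prop :=
  exists g, curve_to_inf g /\
    forall K, exists T, forall t, T <= t -> f (g t) = None \/ K < Cmod (fin f (g t)).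

Definition asymptotic_value (f : C -> Chat) (w : C) : Prop :=
  exists g, curve_to_inf g /\
    forall eps, 0 < eps -> exists T, forall t, T <= t ->
      exists v, f (g t) = Some v /\ Cmod (Cminus v w) < eps.

Definition critical_value (f : C -> Chat) (w : C) : Prop :=
  exists z, f z = Some w /\ cderiv (fin f) z (RtoC 0).

Definition sing (f : C -> Chat) (w : C) : Prop :=
  critical_value f w \/ asymptotic_value f w.

Definition pole_series_cv (f : C -> Chat) (k : nat) (t : R) : Prop :=
  exists B, forall l : list C, NoDup l ->
    List.Forall (fun a => pole_mult f a k /\ a <> RtoC 0) l ->
    fold_right Rplus 0 (map (fun a => Rpower (Cmod a) (- t)) l) <= B.

Definition exponent_is (f : C -> Chat) (rho : R) (k : nat) : Prop :=
  (forall t, rho < t -> pole_series_cv f k t) /\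
  (forall t, t < rho -> ~ pole_series_cv f k t).

Definition is_Mstar (f : C -> Chat) (rho : R) (M Mstar : nat) : Prop :=
  (1 <= Mstar <= M)%nat /\ exponent_is f rho Mstar /\
  forall k, (Mstar < k <= M)%nat -> ~ exponent_is f rho k.

(* Non-autonomous iteration f_n = f0 + c_n, F^n = f_n o ... o f_1.      *)
Definition Fit (f0 : C -> Chat) (c : nat -> C) : nat -> C -> Chat :=
  fix F n z := match n with
  | O => Some z
  | S n' => match F n' z with
            | Some w => match f0 w with
                        | Some v => Some (Cplus v (c (S n')))
                        | None => None
                        end
            | None => None
            end
  end.

Definition chordal (u v : Chat) : R :=
  match u, v with
  | Some z, Some w => 2 * Cmod (Cminus z w) /
                      sqrt ((1 + (Cmod z)^2) * (1 + (Cmod w)^2))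
  | Some z, None | None, Some z => 2 / sqrt (1 + (Cmod z)^2)
  | None, None => 0
  end.

Definition ballC (z : C) (r : R) (w : C) : Prop := Cmod (Cminus w z) < r.

Definition normal_on (F : nat -> C -> Chat) (U : C -> Prop) : Prop :=
  forall phi : nat -> nat, exists (psi : nat -> nat) (g : C -> Chat),
    (forall j, (psi j < psi (S j))%nat) /\
    forall z0, U z0 -> exists r, 0 < r /\ (forall w, ballC z0 r w -> U w) /\
      forall eps, 0 < eps -> exists J, forall j, (J <= j)%nat ->
        forall w, ballC z0 r w -> chordal (F (phi (psi j)) w) (g w) < eps.

Definition fatou (f0 : C -> Chat) (c : nat -> C) (z : C) : Prop :=
  exists r, 0 < r /\
    (forall n w, ballC z r w -> Fit f0 c n w <> None) /\
    normal_on (Fit f0 c) (ballC z r).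

Definition julia (f0 : C -> Chat) (c : nat -> C) (z : C) : Prop :=
  ~ fatou f0 c z.

Definition escaping (f0 : C -> Chat) (c : nat -> C) (z : C) : Prop :=
  julia f0 c z /\
  (forall n, Fit f0 c n z <> None) /\
  (forall K, exists N, forall n, (N <= n)%nat -> K < Cmod (fin (Fit f0 c n) z)).

Definition diam_le (U : C -> Prop) (r : R) : Prop :=
  forall x y, U x -> U y -> Cmod (Cminus x y) <= r.

(* sum_i diam(U_i)^s, with r_i >= diam U_i, empty sets contributing 0 *)
Definition cover_cost (U : nat -> C -> Prop) (r : nat -> R) (s : R) : Rbar :=
  Lub_Rbar (fun x => exists n, x = sum_f_R0 (fun i =>
     if excluded_middle_informative (exists w, U i w) then Rpower (r i) s else 0) n).

Definition hausdorff_content (s d : R) (E : C -> Prop) : Rbar :=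
  Rbar_glb (fun x => exists (U : nat -> C -> Prop) (r : nat -> R),
     (forall i, 0 < r i <= d /\ diam_le (U i) (r i)) /\
     (forall z, E z -> exists i, U i z) /\
     x = cover_cost U r s).

Definition hausdorff_measure (s : R) (E : C -> Prop) : Rbar :=
  Rbar_lub (fun x => exists d, 0 < d /\ x = hausdorff_content s d E).

Definition hausdorff_dim (E : C -> Prop) : Rbar :=
  Rbar_glb (fun x => exists s, 0 <= s /\ x = Finite s /\
                               hausdorff_measure s E = Finite 0).

(* Main.v *)
(** Fix [s < rho m / (beta + m + 1)] with [m = Mstar], and let
    [u = s (beta + m + 1) / m < rho]. Near a large pole [a] of multiplicity [m], (KU4)
    shows that [f0] takes every value close to any other large pole [b], and that two
    points near [a] mapped near [b] are spread apart by a factor of at most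
    [C |b|^(1 + 1/m) |a|^(beta/m)]. So every sequence of large poles is followed by an
    orbit, and two orbits which follow the same poles [a_0, ..., a_(n-1)] and then separate start
    at a distance of at least about [C^(-n) |a_0 ... a_(n-1)|^(-(beta + m + 1)/m)]. As
    [sum |a|^(-u)] diverges, one may draw [a_n] from a finite set of poles over which
    [sum C^(-s) |a|^(-u) >= 2]. The weights [prod (C^(-s) |a_k|^(-u) / 2)] then define a
    mass distribution which excludes covers of small [s]-cost. If these finite sets tend
    to infinity slowly enough, the gain [2^(-n)] absorbs the size of the last pole. The
    points obtained escape; they are in the Julia set since pulling back along the orbit
    contracts, so that prepoles accumulate at them.

    No Cauchy theory is used: a value [v] is attained by minimising [|1/f - 1/v|] on a
    disc, or [|f - v| + lam |x - z|], because these can be decreased wherever the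
    function has a nonconstant leading term. *)
Require Import Defs.
From Stdlib Require Import Reals List Lra Lia Wf_nat.
From Stdlib Require Import Classical ClassicalDescription IndefiniteDescription.
From Coquelicot Require Import Coquelicot.
Open Scope R_scope.

(** * The complex plane *)

Lemma Cmod_minus_sym (x y : C) : Cmod (x - y) = Cmod (y - x).
Proof. rewrite <- Cmod_opp. f_equal. ring. Qed.

Lemma Cmod_minus_triangle (x y z : C) :
  Cmod (x - z) <= Cmod (x - y) + Cmod (y - z).
Proof.
  replace (x - z)%C with ((x - y) + (y - z))%C by ring. apply Cmod_triangle.
Qed.

Lemma Cmod_minus_diag (x : C) : Cmod (x - x) = 0.
Proof. replace (x - x)%C with (RtoC 0) by ring. apply Cmod_0. Qed.

Lemma Cmod_minus_le (x y : C) : Cmod (x - y) <= Cmod x + Cmod y.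
Proof. rewrite <- (Cmod_opp y). apply Cmod_triangle. Qed.

Lemma Cmod_minus_ge (x y : C) : Cmod x - Cmod y <= Cmod (x - y).
Proof.
  enough (Cmod x <= Cmod (x - y) + Cmod y) by lra.
  replace x with ((x - y) + y)%C at 1 by ring. apply Cmod_triangle.
Qed.

Lemma Cmod_minus_gt_0 (x y : C) : x <> y <-> 0 < Cmod (x - y).
Proof.
  rewrite <- Cmod_gt_0. split; intros Hneq E; apply Hneq.
  - replace x with ((x - y) + y)%C by ring. rewrite E. ring.
  - rewrite E. ring.
Qed.

Lemma Cmod_scal (t : R) (z : C) : 0 <= t -> Cmod (RtoC t * z) = t * Cmod z.
Proof. intros Ht. rewrite Cmod_mult, Cmod_R, Rabs_pos_eq; auto. Qed.

Lemma Cpow_pow_n (z : C) (k : nat) : @pow_n C_Ring z k = (z ^ k)%C.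
Proof. induction k as [|k IH]; simpl; [|rewrite IH]; reflexivity. Qed.

Lemma locally_disc (x : C) (P : C -> Prop) :
  locally x P <-> exists del, 0 < del /\ forall y, Cmod (y - x) < del -> P y.
Proof.
  rewrite locally_C. split.
  - intros [del Hdel]. exists del. split; [apply cond_pos|exact Hdel].
  - intros [del [Hpos Hdel]]. exists (mkposreal del Hpos). exact Hdel.
Qed.

Lemma locally_near (x : C) (del : R) :
  0 < del -> locally x (fun y => Cmod (y - x) < del).
Proof. intros Hdel. apply locally_disc. exists del. auto. Qed.

Lemma locally_open_disc (a x : C) (r : R) :
  Cmod (x - a) < r -> locally x (fun y => Cmod (y - a) < r).
Proof.
  intros Hx. apply locally_disc. exists (r - Cmod (x - a)). split; [lra|].
  intros y Hy. pose proof (Cmod_minus_triangle y x a). lra.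
Qed.

Lemma locally_neq (a x : C) : x <> a -> locally x (fun y => y <> a).
Proof.
  intros Hneq. apply Cmod_minus_gt_0 in Hneq. apply locally_disc.
  exists (Cmod (x - a)). split; [exact Hneq|]. intros y Hy ->.
  rewrite Cmod_minus_sym in Hy. lra.
Qed.

Lemma continuous_Cmod (h : C -> C) (x : C) :
  continuous h x <->
  forall eps, 0 < eps -> locally x (fun y => Cmod (h y - h x) < eps).
Proof.
  split.
  - intros Hh eps Heps. exact (Hh _ (locally_near (h x) eps Heps)).
  - intros Hh P HP. apply locally_disc in HP. destruct HP as [eps [Heps HP]].
    unfold filtermap. generalize (Hh eps Heps). apply filter_imp. auto.
Qed.

(** * Compactness of closed discs *)

Definition cluster_point (u : nat -> C) (l : C) : Prop :=
  forall P, locally l P -> forall N, exists n, (N <= n)%nat /\ P (u n).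

Lemma real_bounded_cluster_point (u : nat -> R) (B : R) :
  (forall n, Rabs (u n) <= B) ->
  exists l, forall eps, 0 < eps -> forall N,
    exists n, (N <= n)%nat /\ Rabs (u n - l) < eps.
Proof.
  intros Hu.
  destruct (Bolzano_Weierstrass u _ (compact_P3 (- B) B)) as [l Hl].
  { intros n. apply Rabs_le_between, Hu. }
  exists l. intros eps Heps N.
  apply (Hl (fun x => Rabs (x - l) < eps)).
  exists (mkposreal eps Heps). intros x Hx. exact Hx.
Qed.

Lemma eventually_inv_lt (eps : R) :
  0 < eps -> eventually (fun n => / (INR n + 1) < eps).
Proof.
  intros Heps. destruct (archimed_cor1 eps Heps) as [N [HN Npos]].
  exists N. intros n Hn. eapply Rle_lt_trans; [|exact HN].
  apply lt_INR in Npos. apply le_INR in Hn. simpl in Npos.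
  apply Rinv_le_contravar; lra.
Qed.

Lemma bounded_cluster_point (u : nat -> C) (B : R) :
  (forall n, Cmod (u n) <= B) -> exists l, cluster_point u l.
Proof.
  intros Hu.
  assert (Hcoord : forall n, Rabs (fst (u n)) <= B /\ Rabs (snd (u n)) <= B).
  { intros n. specialize (Hu n). pose proof (Rmax_Cmod (u n)) as Hmax.
    pose proof (Rmax_l (Rabs (fst (u n))) (Rabs (snd (u n)))).
    pose proof (Rmax_r (Rabs (fst (u n))) (Rabs (snd (u n)))). lra. }
  destruct (real_bounded_cluster_point (fun n => fst (u n)) B) as [x Hx].
  { intros n; apply Hcoord. }
  destruct (functional_choice
    (fun k n => (k <= n)%nat /\ Rabs (fst (u n) - x) < / (INR k + 1))) as [phi Hphi].
  { intros k. apply Hx, RinvN_pos. }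
  destruct (real_bounded_cluster_point (fun k => snd (u (phi k))) B) as [y Hy].
  { intros k; apply Hcoord. }
  exists (x, y). intros P HP N.
  destruct HP as [eps HP].
  destruct (eventually_inv_lt eps (cond_pos eps)) as [N0 HN0].
  destruct (Hy eps (cond_pos eps) (Nat.max N N0)) as [k [Hk Hsnd]].
  destruct (Hphi k) as [Hle Hfst]. specialize (HN0 k ltac:(lia)).
  exists (phi k). split; [lia|].
  apply HP. split; [exact (Rlt_trans _ _ _ Hfst HN0)|exact Hsnd].
Qed.

Lemma cluster_point_disc (u : nat -> C) (l a : C) (r : R) :
  cluster_point u l -> eventually (fun n => Cmod (u n - a) <= r) -> Cmod (l - a) <= r.
Proof.
  intros Hl [N HN]. apply Rnot_lt_le. intros Hlt.
  destruct (Hl _ (locally_near l (Cmod (l - a) - r) ltac:(lra)) N) as [n [Hn Hclose]].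
  specialize (HN n Hn). pose proof (Cmod_minus_triangle l (u n) a) as Htri.
  rewrite (Cmod_minus_sym l (u n)) in Htri. lra.
Qed.

Lemma continuous_disc_minimum (g : C -> R) (a : C) (r : R) :
  0 <= r -> (forall x, 0 <= g x) -> (forall x, Cmod (x - a) <= r -> continuous g x) ->
  exists x, Cmod (x - a) <= r /\ forall y, Cmod (y - a) <= r -> g x <= g y.
Proof.
  intros Hr Hpos Hcont.
  set (values := fun t => exists x, Cmod (x - a) <= r /\ t = g x).
  destruct (ex_glb_Rbar values) as [inf [Hlower Hgreatest]].
  assert (Hfin : exists v, inf = Finite v).
  { pose proof (Hgreatest 0) as Hge. pose proof (Hlower (g a)) as Hle.
    destruct inf as [v| |]; [exists v; reflexivity| |].
    - destruct Hle. exists a. rewrite Cmod_minus_diag. auto.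
    - destruct Hge. intros t [x [_ ->]]. apply Hpos. }
  destruct Hfin as [v ->].
  destruct (functional_choice
    (fun n x => Cmod (x - a) <= r /\ g x < v + / (INR n + 1))) as [u Hu].
  { intros n. pose proof (RinvN_pos n) as Hinv. apply NNPP. intros Hnone.
    enough (v + / (INR n + 1) <= v) by lra.
    apply (Hgreatest (v + / (INR n + 1))). intros t [x [Hx ->]].
    apply Rnot_lt_le. intros Hlt. apply Hnone. exists x. auto. }
  destruct (bounded_cluster_point u (Cmod a + r)) as [l Hl].
  { intros n. pose proof (Cmod_minus_ge (u n) a). destruct (Hu n). lra. }
  assert (Hla : Cmod (l - a) <= r).
  { apply (cluster_point_disc u); [exact Hl|]. exists O. intros n _. apply Hu. }
  exists l. split; [exact Hla|]. intros y Hy.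
  apply Rle_trans with v; [|apply (Hlower (g y)); exists y; auto].
  apply Rnot_lt_le. intros Hlt.
  destruct (eventually_inv_lt ((g l - v) / 2) ltac:(lra)) as [N HN].
  assert (Hhalf : 0 < (g l - v) / 2) by lra.
  destruct (Hl _ (Hcont l Hla _ (locally_ball (g l) (mkposreal _ Hhalf))) N)
    as [n [Hn Hball]].
  specialize (HN n Hn). destruct (Hu n) as [_ Hun].
  apply Rabs_lt_between in Hball. simpl in Hball. unfold minus, plus, opp in Hball.
  simpl in Hball. lra.
Qed.

Lemma separated_bounded_finite (X : C -> Prop) (d B : R) : 0 < d ->
  (forall a b, X a -> X b -> a <> b -> d <= Cmod (a - b)) ->
  exists L : list C, forall a, X a -> Cmod a <= B -> In a L.
Proof.
  intros Hd Hsep. apply NNPP. intros Hinf.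
  destruct (functional_choice (fun (L : list C) a => X a /\ Cmod a <= B /\ ~ In a L))
    as [fresh Hfresh].
  { intros L. apply NNPP. intros Hnone. apply Hinf. exists L. intros a Ha HB.
    apply NNPP. intros Hin. apply Hnone. exists a; auto. }
  set (chosen := fix chosen n :=
    match n with O => nil | S k => fresh (chosen k) :: chosen k end).
  set (u := fun n => fresh (chosen n)).
  assert (Hin : forall k n, (k < n)%nat -> In (u k) (chosen n)).
  { intros k n Hk. induction Hk as [|n Hk IH]; [left; reflexivity|right; exact IH]. }
  destruct (bounded_cluster_point u B) as [l Hl].
  { intros n. apply Hfresh. }
  pose proof (locally_near l (d / 2) ltac:(lra)) as Hnear.
  destruct (Hl _ Hnear O) as [k [_ Hk]].
  destruct (Hl _ Hnear (S k)) as [n [Hn Hn_close]].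
  assert (Hfar : d <= Cmod (u n - u k)).
  { apply Hsep; try apply Hfresh. intros E.
    apply (Hfresh (chosen n)). fold (u n). rewrite E. apply Hin. lia. }
  pose proof (Cmod_minus_triangle (u n) l (u k)) as Htri.
  rewrite (Cmod_minus_sym l) in Htri. lra.
Qed.

(** * Leading terms and attained values *)

Definition leading_term (h : C -> C) (x c : C) (m : nat) : Prop :=
  forall eps, 0 < eps -> locally x (fun y =>
    Cmod (h y - h x - c * (y - x) ^ m) <= eps * Cmod (y - x) ^ m).

Lemma cderiv_leading_term (h : C -> C) (x d : C) :
  cderiv h x d -> leading_term h x d 1.
Proof.
  intros [_ Hd] eps Heps. apply locally_C.
  generalize (Hd x (fun P HP => HP) (mkposreal eps Heps)). apply filter_imp.
  intros y Hy. rewrite Cpow_1_r, pow_1, Cmult_comm. exact Hy.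
Qed.

Lemma pow_le_id (t : R) (m : nat) : (1 <= m)%nat -> 0 <= t <= 1 -> t ^ m <= t.
Proof.
  intros Hm Ht. destruct m as [|m]; [lia|]. simpl.
  assert (t ^ m <= 1) by (rewrite <- (pow1 m); apply pow_incr; lra). nra.
Qed.

Lemma leading_term_continuous (h : C -> C) (x c : C) (m : nat) :
  (1 <= m)%nat -> leading_term h x c m -> continuous h x.
Proof.
  intros Hm Hlead. apply continuous_Cmod. intros eps Heps.
  set (rad := Rmin 1 (eps / (Cmod c + 1))).
  pose proof (Cmod_ge_0 c) as Hc.
  assert (Hrad : 0 < rad) by (apply Rmin_pos; [|apply Rdiv_lt_0_compat]; lra).
  generalize (filter_and _ _ (Hlead 1 Rlt_0_1) (locally_near x rad Hrad)).
  apply filter_imp. intros y [Herr Hy].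
  pose proof (Cmod_minus_ge (h y - h x) (c * (y - x) ^ m)) as Htri.
  rewrite Cmod_mult, Cmod_pow in Htri.
  pose proof (Cmod_ge_0 (y - x)) as Hpos.
  pose proof (Rmin_l 1 (eps / (Cmod c + 1))) as Hrad_1. fold rad in Hrad_1.
  assert (Hsmall : Cmod (y - x) * (Cmod c + 1) < eps).
  { apply Rlt_div_r; [lra|]. eapply Rlt_le_trans; [exact Hy|apply Rmin_r]. }
  assert (Cmod (y - x) ^ m <= Cmod (y - x)) by (apply pow_le_id; [exact Hm|lra]).
  nra.
Qed.

Lemma leading_term_ext_loc (g h : C -> C) (x c : C) (m : nat) :
  locally x (fun y => g y = h y) -> leading_term g x c m -> leading_term h x c m.
Proof.
  intros Heq Hlead eps Heps. rewrite <- (locally_singleton _ _ Heq).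
  generalize (filter_and _ _ Heq (Hlead eps Heps)). apply filter_imp.
  intros y [<- Hy]. exact Hy.
Qed.

Lemma leading_term_inv (h : C -> C) (x c : C) (m : nat) :
  (1 <= m)%nat -> h x <> RtoC 0 -> leading_term h x c m ->
  leading_term (fun y => / h y)%C x (- (c / (h x * h x))) m.
Proof.
  intros Hm Hx Hlead eps Heps.
  pose proof (proj1 (Cmod_gt_0 _) Hx) as Hpos. set (s := Cmod (h x)) in *.
  pose proof (Cmod_ge_0 c) as Hc.
  assert (Hsquare : 0 < eps * (s * s)) by (repeat apply Rmult_lt_0_compat; assumption).
  assert (Hcube : 0 < eps * (s * s * s)) by (repeat apply Rmult_lt_0_compat; assumption).
  pose proof (proj1 (continuous_Cmod h x) (leading_term_continuous h x c m Hm Hlead))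
    as Hcont.
  pose proof (Hlead (eps * (s * s) / 4) ltac:(lra)) as Hrem.
  pose proof (Hcont (s / 2) ltac:(lra)) as Hhalf.
  pose proof (Hcont (eps * (s * s * s) / (4 * (Cmod c + 1)))
    ltac:(apply Rdiv_lt_0_compat; lra)) as Hosc.
  generalize (filter_and _ _ Hrem (filter_and _ _ Hhalf Hosc)).
  clear Hrem Hhalf Hosc. apply filter_imp. intros y [Hrem [Hhalf Hosc]].
  apply Rlt_div_r in Hosc; [|lra].
  set (E := (h y - h x - c * (y - x) ^ m)%C) in *.
  set (D := (h y - h x)%C) in *.
  set (t := Cmod (y - x) ^ m) in *.
  assert (Ht : 0 <= t) by apply pow_le, Cmod_ge_0.
  assert (Hhy : s / 2 <= Cmod (h y)).
  { pose proof (Cmod_minus_ge (h x) (h y)) as Htri. rewrite Cmod_minus_sym in Htri.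
    fold D s in Htri. lra. }
  assert (Hy : h y <> RtoC 0) by (apply Cmod_gt_0; lra).
  replace (/ h y - / h x - - (c / (h x * h x)) * (y - x) ^ m)%C
    with ((c * (y - x) ^ m * D - h x * E) / (h y * (h x * h x)))%C
    by (unfold E, D; field; auto).
  rewrite Cmod_div by (repeat apply Cmult_neq_0; assumption).
  rewrite !Cmod_mult. fold s.
  apply Rle_div_l; [apply Rmult_lt_0_compat; nra|].
  eapply Rle_trans; [apply Cmod_minus_le|].
  rewrite !Cmod_mult, Cmod_pow. fold s t.
  assert (Hmain : Cmod c * t * Cmod D <= eps * (s * s * s) / 4 * t).
  { pose proof (Cmod_ge_0 D).
    assert (Cmod c * Cmod D <= eps * (s * s * s) / 4) by lra. nra. }
  assert (Hrest : s * Cmod E <= eps * (s * s * s) / 4 * t) by nra.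
  assert (Hden : eps * t * (s * s * (s / 2)) <= eps * t * (Cmod (h y) * (s * s))).
  { apply Rmult_le_compat_l; nra. }
  lra.
Qed.

Lemma continuous_Cinv (w : C) : w <> RtoC 0 -> continuous Cinv w.
Proof.
  intros Hw.
  apply (leading_term_continuous Cinv w (- (1 / (w * w))) 1 (le_n 1)).
  apply (leading_term_inv (fun y => y) w 1 1 (le_n 1) Hw). intros eps Heps.
  apply filter_forall. intros y.
  replace (y - w - 1 * (y - w) ^ 1)%C with (RtoC 0) by (simpl; ring).
  rewrite Cmod_0. apply Rmult_le_pos; [lra|apply pow_le, Cmod_ge_0].
Qed.

Lemma polar_form (w : C) : exists th, w = (RtoC (Cmod w) * (cos th, sin th))%C.
Proof.
  destruct (Req_dec (Cmod w) 0) as [Hzero|Hnonzero].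
  { exists 0. rewrite (Cmod_eq_0 w Hzero), Cmod_0. ring. }
  destruct w as [x y]. set (rad := Cmod (x, y)) in *.
  assert (Hsq : rad * rad = x * x + y * y).
  { pose proof (Cmod2_alt (x, y)) as Halt. unfold Re, Im in Halt. simpl in Halt.
    fold rad in Halt. lra. }
  assert (Hcos : (x / rad) * (x / rad) = 1 - (y / rad) * (y / rad)).
  { replace (x / rad * (x / rad)) with ((x * x) / (rad * rad)) by (field; lra).
    replace (x * x) with (rad * rad - y * y) by lra. field. lra. }
  assert (Hrange : -1 <= x / rad <= 1) by nra.
  assert (Hsin : sin (acos (x / rad)) = Rabs (y / rad)).
  { rewrite sin_acos by exact Hrange. rewrite <- sqrt_Rsqr_abs. f_equal.
    unfold Rsqr. lra. }
  assert (Hx : x = rad * (x / rad)) by (field; lra).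
  assert (Hy : y = rad * (y / rad)) by (field; lra).
  destruct (Rle_dec 0 (y / rad)) as [Hge|Hlt].
  - exists (acos (x / rad)). rewrite cos_acos, Hsin, Rabs_pos_eq by assumption.
    unfold Cmult; simpl. f_equal; lra.
  - exists (- acos (x / rad)).
    rewrite cos_neg, sin_neg, cos_acos, Hsin, Rabs_left by lra.
    unfold Cmult; simpl. f_equal; lra.
Qed.

Lemma de_Moivre (th : R) (k : nat) :
  Cpow (cos th, sin th) k = (cos (INR k * th), sin (INR k * th)).
Proof.
  induction k as [|k IH].
  - simpl. rewrite Rmult_0_l, cos_0, sin_0. reflexivity.
  - rewrite S_INR. replace ((INR k + 1) * th) with (th + INR k * th) by ring.
    rewrite cos_plus, sin_plus, Cpow_S, IH. unfold Cmult; simpl. f_equal. ring.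
Qed.

Lemma Croot_exists (w : C) (m : nat) :
  w <> RtoC 0 -> (1 <= m)%nat -> exists zeta : C, (zeta ^ m)%C = w.
Proof.
  intros Hw Hm. apply Cmod_gt_0 in Hw.
  assert (HM : 0 < INR m) by (apply lt_0_INR; lia).
  destruct (polar_form w) as [th Hth].
  exists (RtoC (Rpower (Cmod w) (/ INR m)) * (cos (th / INR m), sin (th / INR m)))%C.
  rewrite Cpow_mult_l, <- RtoC_pow, de_Moivre.
  rewrite <- Rpower_pow, Rpower_mult, Rinv_l, Rpower_1 by (try apply exp_pos; lra).
  replace (INR m * (th / INR m)) with th by (field; lra). symmetry. exact Hth.
Qed.

Lemma leading_term_ray (h : C -> C) (x c zeta : C) (m : nat) (eps del : R) :
  leading_term h x c m -> 0 < eps -> 0 < del ->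
  exists t, 0 < t <= 1 /\ t * Cmod zeta < del /\
    Cmod (h (x + RtoC t * zeta)%C - h x - RtoC (t ^ m) * (c * zeta ^ m)) <=
    eps * (t ^ m * Cmod zeta ^ m).
Proof.
  intros Hlead Heps Hdel.
  destruct (proj1 (locally_disc _ _) (Hlead eps Heps)) as [rad [Hrad Herr]].
  pose proof (Cmod_ge_0 zeta) as Hzeta.
  pose proof (Rmin_pos _ _ Hdel Hrad) as Hmin.
  set (t := Rmin 1 (Rmin del rad / (Cmod zeta + 1))).
  assert (Ht : 0 < t) by (apply Rmin_pos; [|apply Rdiv_lt_0_compat]; lra).
  assert (Hshort : t * (Cmod zeta + 1) <= Rmin del rad).
  { apply Rle_div_r; [lra|apply Rmin_r]. }
  pose proof (Rmin_l del rad). pose proof (Rmin_r del rad).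
  exists t. split; [split; [exact Ht|apply Rmin_l]|]. split; [lra|].
  assert (Hmove : (x + RtoC t * zeta - x = RtoC t * zeta)%C) by ring.
  assert (Hdist : Cmod (x + RtoC t * zeta - x) = t * Cmod zeta).
  { rewrite Hmove. apply Cmod_scal. lra. }
  specialize (Herr (x + RtoC t * zeta)%C ltac:(rewrite Hdist; lra)).
  rewrite Hdist, Hmove, Rpow_mult_distr, Cpow_mult_l, <- RtoC_pow in Herr.
  replace (RtoC (t ^ m) * (c * zeta ^ m))%C with (c * (RtoC (t ^ m) * zeta ^ m))%C by ring.
  exact Herr.
Qed.

(* With [zeta^m = - (h x - v) / c], moving from [x] to [x + t zeta] multiplies [h - v]
   by [1 - t^m], up to an error which is small compared to [t^m]. *)
Lemma leading_term_descent (h : C -> C) (x c v : C) (m : nat) (lam del : R) :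
  (1 <= m)%nat -> leading_term h x c m -> 0 <= lam < Cmod c -> h x <> v -> 0 < del ->
  exists y, Cmod (y - x) < del /\
    Cmod (h y - v) + lam * Cmod (y - x) ^ m < Cmod (h x - v).
Proof.
  intros Hm Hlead Hlam Hv Hdel.
  assert (Hc : c <> RtoC 0) by (apply Cmod_gt_0; lra).
  pose proof (proj1 (Cmod_minus_gt_0 _ _) Hv) as Hw. set (w := (h x - v)%C) in *.
  assert (Hdir : (- (w / c))%C <> RtoC 0).
  { apply Cmod_gt_0. rewrite Cmod_opp, Cmod_div by exact Hc.
    apply Rdiv_lt_0_compat; lra. }
  destruct (Croot_exists _ m Hdir Hm) as [zeta Hzeta].
  assert (Hzeta_pow : Cmod zeta ^ m * Cmod c = Cmod w).
  { rewrite <- Cmod_pow, Hzeta, Cmod_opp, Cmod_div by exact Hc. field. lra. }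
  destruct (leading_term_ray h x c zeta m ((Cmod c - lam) / 2) del Hlead ltac:(lra) Hdel)
    as [t [Ht [Hshort Herr]]].
  exists (x + RtoC t * zeta)%C.
  replace (x + RtoC t * zeta - x)%C with (RtoC t * zeta)%C by ring.
  rewrite Cmod_scal, Rpow_mult_distr by lra. split; [exact Hshort|].
  rewrite Hzeta in Herr.
  replace (c * - (w / c))%C with (- w)%C in Herr by (field; exact Hc).
  assert (Htm : 0 < t ^ m <= 1).
  { split; [apply pow_lt; lra|]. rewrite <- (pow1 m). apply pow_incr. lra. }
  set (err := (h (x + RtoC t * zeta)%C - h x - RtoC (t ^ m) * - w)%C) in *.
  assert (Hsplit : (h (x + RtoC t * zeta) - v = RtoC (1 - t ^ m) * w + err)%C).
  { unfold err, w. rewrite RtoC_minus. ring. }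
  rewrite Hsplit. pose proof (Cmod_triangle (RtoC (1 - t ^ m) * w) err) as Htri.
  rewrite Cmod_scal in Htri by lra.
  assert (Hgain : ((Cmod c - lam) / 2 + lam) * (t ^ m * Cmod zeta ^ m) < t ^ m * Cmod w).
  { rewrite <- Hzeta_pow. assert (0 < t ^ m * Cmod zeta ^ m) by nra. nra. }
  lra.
Qed.

(* The minimiser of [|h - v| + lam |. - z|] on the disc must solve [h x = v]. *)
Lemma descent_attains_value (h : C -> C) (z v : C) (r lam : R) :
  0 <= r -> 0 <= lam ->
  (forall x, Cmod (x - z) <= r -> continuous h x) ->
  (forall x, Cmod (x - z) = r -> Cmod (h z - v) < Cmod (h x - v) + lam * r) ->
  (forall x del, Cmod (x - z) < r -> h x <> v -> 0 < del -> exists y,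
     Cmod (y - x) < del /\ Cmod (h y - v) + lam * Cmod (y - x) < Cmod (h x - v)) ->
  exists x, Cmod (x - z) < r /\ h x = v /\ lam * Cmod (x - z) <= Cmod (h z - v).
Proof.
  intros Hr Hlam Hcont Hbd Hdescent.
  destruct (continuous_disc_minimum
    (fun x => Cmod (h x - v) + lam * Cmod (x - z)) z r) as [x [Hx Hmin]].
  - exact Hr.
  - intros x. pose proof (Cmod_ge_0 (h x - v)). pose proof (Cmod_ge_0 (x - z)). nra.
  - intros x Hx.
    assert (Hdist : forall g b, continuous g x -> continuous (fun y => Cmod (g y - b)) x).
    { intros g b Hg. apply (continuous_comp (fun y => g y - b)%C Cmod).
      - apply (continuous_minus g (fun _ => b)); [exact Hg|apply continuous_const].
      - apply (@filterlim_norm C_AbsRing C_NormedModule). }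
    apply (continuous_plus (fun y => Cmod (h y - v)) (fun y => lam * Cmod (y - z))).
    + apply Hdist, Hcont, Hx.
    + apply (continuous_scal_r lam (fun y => Cmod (y - z))).
      apply (Hdist (fun y => y)), continuous_id.
  - pose proof (Hmin z ltac:(rewrite Cmod_minus_diag; exact Hr)) as Hcenter.
    rewrite Cmod_minus_diag in Hcenter.
    assert (Hinner : Cmod (x - z) < r).
    { destruct Hx as [Hlt|Hx]; [exact Hlt|]. specialize (Hbd x Hx).
      rewrite Hx in Hcenter. lra. }
    exists x. repeat split; [exact Hinner| |pose proof (Cmod_ge_0 (h x - v)); lra].
    apply NNPP. intros Hneq.
    destruct (Hdescent x (r - Cmod (x - z)) Hinner Hneq ltac:(lra)) as [y [Hy Hless]].
    pose proof (Cmod_minus_triangle y x z) as Htri.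
    specialize (Hmin y ltac:(lra)). nra.
Qed.

Lemma is_derive_Re_line (h : C -> C) (k x e d : C) (t : R) :
  leading_term h (x + RtoC t * e) d 1 ->
  is_derive (fun s : R => Re (k * h (x + RtoC s * e)%C)%C) t (Re (k * (d * e))%C).
Proof.
  intros Hlead. split; [apply is_linear_scal_l|].
  intros t' Ht'.
  apply (is_filter_lim_locally_unique (V := AbsRing_NormedModule R_AbsRing)) in Ht'.
  subst t'. intros eps. set (scale := Cmod k * Cmod e + 1).
  pose proof (Cmod_ge_0 k) as Hk. pose proof (Cmod_ge_0 e) as He.
  assert (Hscale : 0 < scale) by (unfold scale; nra).
  destruct (proj1 (locally_disc _ _)
    (Hlead (eps / scale) (Rdiv_lt_0_compat _ _ (cond_pos eps) Hscale)))
    as [del [Hdel Herr]].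
  assert (Hrad : 0 < del / (Cmod e + 1)) by (apply Rdiv_lt_0_compat; lra).
  exists (mkposreal _ Hrad). intros s Hs.
  change (Rabs (s - t) < del / (Cmod e + 1)) in Hs.
  apply Rlt_div_r in Hs; [|lra].
  specialize (Herr (x + RtoC s * e)%C).
  replace (x + RtoC s * e - (x + RtoC t * e))%C with (RtoC (s - t) * e)%C in Herr
    by (rewrite RtoC_minus; ring).
  rewrite Cpow_1_r, pow_1, Cmod_mult, Cmod_R in Herr.
  pose proof (Rabs_pos (s - t)) as Hst.
  specialize (Herr ltac:(nra)).
  set (E := (h (x + RtoC s * e) - h (x + RtoC t * e) - d * (RtoC (s - t) * e))%C) in *.
  change (Rabs (Re (k * h (x + RtoC s * e)%C)%C - Re (k * h (x + RtoC t * e)%C)%C -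
    (s - t) * Re (k * (d * e))%C) <= eps * Rabs (s - t)).
  replace (Re (k * h (x + RtoC s * e)%C)%C - Re (k * h (x + RtoC t * e)%C)%C -
    (s - t) * Re (k * (d * e))%C) with (Re (k * E)%C)
    by (unfold E, Re, Cminus, Cplus, Copp, Cmult, RtoC; simpl; ring).
  eapply Rle_trans; [apply re_le_Cmod|]. rewrite Cmod_mult.
  apply Rle_trans with (Cmod k * (eps / scale * (Rabs (s - t) * Cmod e))).
  - apply Rmult_le_compat_l; assumption.
  - assert (Hratio : eps / scale * (Cmod k * Cmod e) <= eps).
    { apply Rle_trans with (eps / scale * scale); [|apply Req_le; field; lra].
      pose proof (Rdiv_lt_0_compat _ _ (cond_pos eps) Hscale).
      apply Rmult_le_compat_l; [lra|]. unfold scale. lra. }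
    apply (Rmult_le_compat_r (Rabs (s - t))) in Hratio; [|exact Hst].
    apply Rle_trans with (eps / scale * (Cmod k * Cmod e) * Rabs (s - t)); [|lra].
    apply Req_le. ring.
Qed.

Lemma Cmod_mean_value (h : C -> C) (x y : C) (B : R) :
  (forall t, 0 <= t <= 1 -> exists d,
     leading_term h (x + RtoC t * (y - x)) d 1 /\ Cmod d <= B) ->
  Cmod (h y - h x) <= B * Cmod (y - x).
Proof.
  intros Hderiv. set (w := (h y - h x)%C).
  destruct (functional_choice (fun t d => 0 <= t <= 1 ->
    leading_term h (x + RtoC t * (y - x)) d 1 /\ Cmod d <= B)) as [D HD].
  { intros t. destruct (classic (0 <= t <= 1)) as [Ht|Ht].
    - destruct (Hderiv t Ht) as [d Hd]. exists d. auto.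
    - exists (RtoC 0). tauto. }
  set (g := fun t : R => Re (Cconj w * h (x + RtoC t * (y - x))%C)%C).
  destruct (MVT_cor2 g (fun t => Re (Cconj w * (D t * (y - x)))%C) 0 1 Rlt_0_1)
    as [t [Hincr Ht]].
  { intros t Ht. apply is_derive_Reals, is_derive_Re_line, HD, Ht. }
  assert (Hends : g 1 - g 0 = Cmod w * Cmod w).
  { unfold g. replace (x + RtoC 1 * (y - x))%C with y by ring.
    replace (x + RtoC 0 * (y - x))%C with x by ring.
    replace (Cmod w * Cmod w) with (Cmod w ^ 2) by ring. rewrite Cmod2_alt.
    unfold w, Re, Im, Cconj, Cminus, Cplus, Cmult, Copp; simpl. ring. }
  destruct (HD t ltac:(lra)) as [_ Hbound].
  pose proof (re_le_Cmod (Cconj w * (D t * (y - x)))) as Hre.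
  rewrite !Cmod_mult, Cmod_conj in Hre.
  rewrite Hends, Rminus_0_r, Rmult_1_r in Hincr.
  pose proof (Rle_abs (Re (Cconj w * (D t * (y - x)))%C)) as Habs.
  pose proof (Cmod_ge_0 w). pose proof (Cmod_ge_0 (y - x)).
  destruct (Req_dec (Cmod w) 0) as [Hzero|Hnonzero].
  { rewrite Hzero. pose proof (Cmod_ge_0 (D t)). nra. }
  apply Rmult_le_reg_l with (Cmod w); [lra|].
  apply Rle_trans with (Cmod w * (Cmod (D t) * Cmod (y - x))); [lra|].
  apply Rmult_le_compat_l; [lra|]. apply Rmult_le_compat_r; lra.
Qed.

(** * Finite sums *)

Definition lsum {A : Type} (w : A -> R) (l : list A) : R :=
  fold_right Rplus 0 (map w l).

Lemma lsum_cons {A : Type} (w : A -> R) (a : A) (l : list A) :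
  lsum w (a :: l) = w a + lsum w l.
Proof. reflexivity. Qed.

Lemma lsum_le {A : Type} (v w : A -> R) (l : list A) :
  (forall a, In a l -> v a <= w a) -> lsum v l <= lsum w l.
Proof.
  induction l as [|a l IH]; intros Hle; [apply Rle_refl|].
  rewrite !lsum_cons. apply Rplus_le_compat; [apply Hle; left; reflexivity|].
  apply IH. intros b Hb. apply Hle. right. exact Hb.
Qed.

Lemma lsum_scal {A : Type} (c : R) (w : A -> R) (l : list A) :
  lsum (fun a => c * w a) l = c * lsum w l.
Proof.
  induction l as [|a l IH]; [unfold lsum; simpl; ring|]. rewrite !lsum_cons, IH. ring.
Qed.

Lemma lsum_nonneg {A : Type} (w : A -> R) (l : list A) :
  (forall a, In a l -> 0 <= w a) -> 0 <= lsum w l.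
Proof.
  intros Hw. rewrite <- (Rmult_0_l (lsum w l)), <- lsum_scal. apply lsum_le.
  intros a Ha. specialize (Hw a Ha). lra.
Qed.

Lemma lsum_plus {A : Type} (v w : A -> R) (l : list A) :
  lsum (fun a => v a + w a) l = lsum v l + lsum w l.
Proof.
  induction l as [|a l IH]; [unfold lsum; simpl; ring|]. rewrite !lsum_cons, IH. ring.
Qed.

Lemma lsum_app {A : Type} (w : A -> R) (k l : list A) :
  lsum w (k ++ l) = lsum w k + lsum w l.
Proof.
  induction k as [|a k IH]; [unfold lsum; simpl; ring|].
  simpl. rewrite !lsum_cons, IH. ring.
Qed.

Lemma lsum_sum_f_R0 {A : Type} (u : A -> nat -> R) (l : list A) (N : nat) :
  lsum (fun a => sum_f_R0 (u a) N) l = sum_f_R0 (fun i => lsum (fun a => u a i) l) N.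
Proof.
  induction N as [|N IH]; simpl; [reflexivity|]. rewrite lsum_plus, IH. reflexivity.
Qed.

Lemma lsum_filter {A : Type} (w : A -> R) (p : A -> bool) (l : list A) :
  lsum w l = lsum w (filter p l) + lsum w (filter (fun a => negb (p a)) l).
Proof.
  induction l as [|a l IH]; [unfold lsum; simpl; ring|].
  simpl. destruct (p a); simpl; rewrite !lsum_cons, IH; ring.
Qed.

Lemma lsum_incl {A : Type} (w : A -> R) (k l : list A) :
  (forall a, 0 <= w a) -> NoDup k -> incl k l -> lsum w k <= lsum w l.
Proof.
  intros Hw Hnodup. revert l. induction Hnodup as [|a k Ha Hnodup IH]; intros l Hincl.
  - apply lsum_nonneg. auto.
  - destruct (in_split a l) as [front [back ->]]; [apply Hincl; left; reflexivity|].
    rewrite lsum_app, !lsum_cons.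
    enough (lsum w k <= lsum w (front ++ back)) by (rewrite lsum_app in *; lra).
    apply IH. intros b Hb.
    specialize (Hincl b (or_intror Hb)). rewrite in_app_iff in *.
    destruct Hincl as [|[<-|]]; tauto.
Qed.

Lemma lsum_pigeonhole {A : Type} (v w : A -> R) (l : list A) :
  l <> nil -> lsum v l <= lsum w l -> exists a, In a l /\ v a <= w a.
Proof.
  intros Hne Hle. apply NNPP. intros Hnone.
  enough (lsum w l < lsum v l) by lra. clear Hle.
  assert (Hlt : forall a, In a l -> w a < v a).
  { intros a Ha. apply Rnot_le_lt. intros Hle. apply Hnone. exists a. auto. }
  clear Hnone. destruct l as [|a l]; [tauto|]. rewrite !lsum_cons.
  apply Rplus_lt_le_compat; [apply Hlt; left; reflexivity|].
  apply lsum_le. intros b Hb. apply Rlt_le, Hlt. right. exact Hb.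
Qed.

Lemma finite_choice_antitone {A : Type} (l : list A) (P : A -> nat -> Prop) :
  (forall a n n', (n <= n')%nat -> P a n' -> P a n) ->
  (forall n, exists a, In a l /\ P a n) -> exists a, In a l /\ forall n, P a n.
Proof.
  intros Hanti Hex. apply NNPP. intros Hnone.
  assert (Hbound : exists n, forall a, In a l -> ~ P a n).
  { clear Hex. induction l as [|a l IH]; [exists O; intros a []|].
    destruct IH as [n Hn].
    { intros [b [Hb HP]]. apply Hnone. exists b. split; [right|]; assumption. }
    assert (Ha : exists n', ~ P a n').
    { apply not_all_ex_not. intros HP. apply Hnone.
      exists a. split; [left; reflexivity|exact HP]. }
    destruct Ha as [n' Hn']. exists (Nat.max n n').
    intros b [<-|Hb] HP.
    - apply Hn'. apply (Hanti a _ (Nat.max n n')); [lia|exact HP].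
    - apply (Hn b Hb). apply (Hanti b _ (Nat.max n n')); [lia|exact HP]. }
  destruct Hbound as [n Hn]. destruct (Hex n) as [a [Ha HP]]. exact (Hn a Ha HP).
Qed.

Lemma sum_f_R0_extend (u : nat -> R) (N N' : nat) :
  (forall i, 0 <= u i) -> (N <= N')%nat -> sum_f_R0 u N <= sum_f_R0 u N'.
Proof.
  intros Hu HN. induction HN as [|N' HN IH]; [lra|]. simpl. pose proof (Hu (S N')). lra.
Qed.

Lemma sum_f_R0_ge_last (u : nat -> R) (N : nat) :
  (forall i, 0 <= u i) -> u N <= sum_f_R0 u N.
Proof.
  intros Hu. destruct N as [|N]; simpl; [lra|]. pose proof (cond_pos_sum u N Hu). lra.
Qed.

Definition value_if (P : Prop) (v : R) : R :=
  if excluded_middle_informative P then v else 0.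

Lemma value_if_true (P : Prop) (v : R) : P -> value_if P v = v.
Proof. intros HP. unfold value_if. destruct excluded_middle_informative; tauto. Qed.

Lemma value_if_false (P : Prop) (v : R) : ~ P -> value_if P v = 0.
Proof. intros HP. unfold value_if. destruct excluded_middle_informative; tauto. Qed.

Lemma value_if_nonneg (P : Prop) (v : R) : 0 <= v -> 0 <= value_if P v.
Proof. intros Hv. unfold value_if. destruct excluded_middle_informative; lra. Qed.

Lemma value_if_le (P Q : Prop) (u v : R) :
  0 <= v -> (P -> Q /\ u <= v) -> value_if P u <= value_if Q v.
Proof.
  intros Hv Himp. destruct (classic P) as [HP|HP].
  - destruct (Himp HP) as [HQ Huv]. rewrite !value_if_true; assumption.
  - rewrite (value_if_false P u HP). apply value_if_nonneg, Hv.
Qed.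

Lemma lsum_value_if_le {A : Type} (P : A -> Prop) (Q : Prop) (v : R) (l : list A) :
  NoDup l -> 0 <= v -> (forall a, P a -> Q) -> (forall a b, P a -> P b -> a = b) ->
  lsum (fun a => value_if (P a) v) l <= value_if Q v.
Proof.
  intros Hnodup Hv HQ Huniq. induction Hnodup as [|a l Ha Hnodup IH].
  { apply value_if_nonneg, Hv. }
  rewrite lsum_cons. destruct (classic (P a)) as [HPa|HPa].
  - assert (Hrest : lsum (fun b => value_if (P b) v) l <= 0).
    { rewrite <- (Rmult_0_l (lsum (fun _ => v) l)), <- lsum_scal. apply lsum_le.
      intros b Hb. rewrite value_if_false; [lra|]. intros HPb.
      apply Ha. rewrite (Huniq a b HPa HPb). exact Hb. }
    rewrite !value_if_true by eauto. lra.
  - rewrite value_if_false by exact HPa. lra.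
Qed.

(** * Mass distribution on trees *)

Definition lprod {A : Type} (w : A -> R) (l : list A) : R :=
  fold_right Rmult 1 (map w l).

Lemma lprod_pos {A : Type} (w : A -> R) (l : list A) :
  (forall a, 0 < w a) -> 0 < lprod w l.
Proof.
  intros Hw. unfold lprod. induction l as [|a l IH]; simpl; [lra|].
  apply Rmult_lt_0_compat; auto.
Qed.

Fixpoint prefix {A : Type} (x : nat -> A) (n : nat) : list A :=
  match n with O => nil | S k => x k :: prefix x k end.

Lemma prefix_length {A : Type} (x : nat -> A) (n : nat) : length (prefix x n) = n.
Proof. induction n as [|n IH]; simpl; [|rewrite IH]; reflexivity. Qed.

Lemma prefix_ext {A : Type} (x y : nat -> A) (n : nat) :
  (forall k, (k < n)%nat -> x k = y k) -> prefix x n = prefix y n.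
Proof.
  induction n as [|n IH]; intros Heq; simpl; [reflexivity|].
  rewrite (Heq n) by lia. f_equal. apply IH. intros k Hk. apply Heq. lia.
Qed.

Definition branch {A : Type} (T : nat -> list A) (x : nat -> A) : Prop :=
  forall k, In (x k) (T k).

Lemma branch_of_step {A : Type} (T : nat -> list A) (good : list A -> Prop) :
  good nil -> (forall p, good p -> exists a, In a (T (length p)) /\ good (a :: p)) ->
  exists x, branch T x /\ forall n, good (prefix x n).
Proof.
  intros Hnil Hstep. destruct (Hstep nil Hnil) as [a0 _].
  destruct (functional_choice (fun p a => good p -> In a (T (length p)) /\ good (a :: p)))
    as [next Hnext].
  { intros p. destruct (classic (good p)) as [Hp|Hp].
    - destruct (Hstep p Hp) as [a Ha]. exists a. auto.
    - exists a0. tauto. }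
  set (node := fix node n := match n with O => nil | S k => next (node k) :: node k end).
  set (x := fun k => next (node k)).
  assert (Hnode : forall n, node n = prefix x n).
  { induction n as [|n IH]; simpl; [reflexivity|]. rewrite IH at 2. reflexivity. }
  assert (Hgood : forall n, good (prefix x n)).
  { induction n as [|n IH]; [exact Hnil|]. rewrite <- Hnode in *.
    exact (proj2 (Hnext _ IH)). }
  exists x. split; [|exact Hgood]. intros k. unfold x. rewrite Hnode.
  rewrite <- (prefix_length x k) at 2. exact (proj1 (Hnext _ (Hgood k))).
Qed.

Section AvoidingBranch.
Context {A : Type} (T : nat -> list A) (w : A -> R).
Context (active : nat -> Prop) (word : nat -> list A).
Hypothesis w_pos : forall a, 0 < w a.
Hypothesis T_nodup : forall n, NoDup (T n).
Hypothesis T_weight : forall n, 1 <= lsum w (T n).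

Definition extends (q p : list A) : Prop := exists t, q = t ++ p.

Definition mass (p : list A) (N : nat) : R :=
  sum_f_R0 (fun i => value_if (active i /\ extends (word i) p) (lprod w (word i))) N.

Lemma mass_term_nonneg p i :
  0 <= value_if (active i /\ extends (word i) p) (lprod w (word i)).
Proof. apply value_if_nonneg, Rlt_le, lprod_pos, w_pos. Qed.

Lemma mass_children_le p n N : lsum (fun a => mass (a :: p) N) (T n) <= mass p N.
Proof.
  unfold mass. rewrite lsum_sum_f_R0. apply sum_Rle. intros i _.
  apply lsum_value_if_le; [apply T_nodup|apply Rlt_le, lprod_pos, w_pos| |].
  - intros a [Hact [t Ht]]. split; [exact Hact|].
    exists (t ++ a :: nil). rewrite Ht, <- app_assoc. reflexivity.
  - intros a b [_ [s Hs]] [_ [t Ht]]. rewrite Hs in Ht.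
    change (a :: p) with ((a :: nil) ++ p) in Ht.
    change (b :: p) with ((b :: nil) ++ p) in Ht.
    rewrite !app_assoc in Ht. apply app_inv_tail, app_inj_tail in Ht. apply Ht.
Qed.

Lemma light_child_exists theta p n : 0 <= theta ->
  (forall N, mass p N <= theta * lprod w p) ->
  exists a, In a (T n) /\ forall N, mass (a :: p) N <= theta * lprod w (a :: p).
Proof.
  intros Htheta Hlight. apply finite_choice_antitone.
  - intros a N N' HN. apply Rle_trans, sum_f_R0_extend; [|exact HN].
    apply mass_term_nonneg.
  - intros N. apply lsum_pigeonhole.
    { intros Hempty. pose proof (T_weight n) as Hsum. rewrite Hempty in Hsum.
      unfold lsum in Hsum. simpl in Hsum. lra. }
    eapply Rle_trans; [apply mass_children_le|].
    eapply Rle_trans; [apply Hlight|].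
    apply Rle_trans with (lsum (fun a => theta * lprod w p * w a) (T n)).
    + rewrite lsum_scal, <- (Rmult_1_r (theta * lprod w p)) at 1.
      apply Rmult_le_compat_l; [|apply T_weight].
      apply Rmult_le_pos; [exact Htheta|apply Rlt_le, lprod_pos, w_pos].
    + apply lsum_le. intros a _. apply Req_le. unfold lprod. simpl. ring.
Qed.

(* Descend the tree, always to a child of which the words occupy at most a proportion
   [theta]. *)
Lemma avoiding_branch theta : 0 <= theta < 1 ->
  (forall N, sum_f_R0 (fun i => value_if (active i) (lprod w (word i))) N <= theta) ->
  exists x, branch T x /\
    forall i, active i -> prefix x (length (word i)) <> word i.
Proof.
  intros Htheta Hcost.
  destruct (branch_of_step T (fun p => forall N, mass p N <= theta * lprod w p))
    as [x [Hx Hlight]].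
  - intros N. unfold lprod; simpl. rewrite Rmult_1_r. eapply Rle_trans; [|apply Hcost].
    apply sum_Rle. intros i _. apply value_if_le; [apply Rlt_le, lprod_pos, w_pos|].
    intros [Hact _]. split; [exact Hact|apply Rle_refl].
  - intros p Hp. apply light_child_exists; [lra|exact Hp].
  - exists x. split; [exact Hx|]. intros i Hact Heq.
    specialize (Hlight (length (word i)) i). rewrite Heq in Hlight.
    assert (Hterm : lprod w (word i) <= mass (word i) i).
    { eapply Rle_trans; [|apply sum_f_R0_ge_last, mass_term_nonneg].
      rewrite value_if_true; [apply Rle_refl|].
      split; [exact Hact|]. exists nil. reflexivity. }
    pose proof (lprod_pos w (word i) w_pos). nra.
Qed.

End AvoidingBranch.

Lemma first_divergence {A : Type} (Y : (nat -> A) -> Prop) (x : nat -> A) :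
  (forall y n, Y y -> prefix y n = prefix x n) \/
  exists n y, Y y /\ y n <> x n /\ forall y', Y y' -> prefix y' n = prefix x n.
Proof.
  destruct (classic (exists n y, Y y /\ y n <> x n)) as [Hdiv|Hsame].
  - right. destruct (dec_inh_nat_subset_has_unique_least_element
      (fun n => exists y, Y y /\ y n <> x n)) as [n [[[y [Hy Hneq]] Hleast] _]].
    { intros n. apply classic. }
    { exact Hdiv. }
    exists n, y. split; [exact Hy|]. split; [exact Hneq|]. intros y' Hy'.
    apply prefix_ext. intros k Hk. apply NNPP. intros Hk_neq.
    enough (n <= k)%nat by lia. apply Hleast. exists y'. auto.
  - left. intros y n Hy. apply prefix_ext. intros k _. apply NNPP. intros Hneq.
    apply Hsame. exists k, y. auto.
Qed.

Lemma Rbar_glb_correct (X : Rbar -> Prop) : Rbar_is_glb X (Rbar_glb X).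
Proof. exact (proj2_sig (Rbar_ex_glb X)). Qed.

Lemma Rbar_lub_correct (X : Rbar -> Prop) : Rbar_is_lub X (Rbar_lub X).
Proof. exact (proj2_sig (Rbar_ex_lub X)). Qed.

Lemma hausdorff_measure_0_cover (E : C -> Prop) (s d eta : R) :
  0 < d -> 0 < eta -> hausdorff_measure s E = Finite 0 ->
  exists (U : nat -> C -> Prop) (r : nat -> R),
    (forall i, 0 < r i <= d /\ diam_le (U i) (r i)) /\
    (forall z, E z -> exists i, U i z) /\ Rbar_lt (cover_cost U r s) eta.
Proof.
  intros Hd Heta Hzero. apply NNPP. intros Hnone.
  assert (Hcontent : Rbar_le eta (hausdorff_content s d E)).
  { apply (Rbar_glb_correct _). intros cost [U [r [Hr [Hcover ->]]]].
    apply Rbar_not_lt_le. intros Hlt. apply Hnone. exists U, r. auto. }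
  assert (Hmeasure : Rbar_le (hausdorff_content s d E) (hausdorff_measure s E)).
  { apply (Rbar_lub_correct _). exists d. auto. }
  rewrite Hzero in Hmeasure.
  pose proof (Rbar_le_trans _ _ _ Hcontent Hmeasure) as Habsurd. simpl in Habsurd. lra.
Qed.

Lemma cover_cost_partial (U : nat -> C -> Prop) (r : nat -> R) (s eta : R) (N : nat) :
  Rbar_lt (cover_cost U r s) eta ->
  sum_f_R0 (fun i => value_if (exists z, U i z) (Rpower (r i) s)) N < eta.
Proof.
  intros Hcost.
  assert (Hle : Rbar_le
    (sum_f_R0 (fun i => value_if (exists z, U i z) (Rpower (r i) s)) N)
    (cover_cost U r s)).
  { apply (proj1 (Lub_Rbar_correct _)). exists N. reflexivity. }
  exact (Rbar_le_lt_trans _ _ _ Hle Hcost).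
Qed.

Section MassDistribution.
Context {A : Type} (T : nat -> list A) (w : A -> R).
Context (code : (nat -> A) -> C -> Prop) (E : C -> Prop) (s K : R).
Hypothesis w_pos : forall a, 0 < w a.
Hypothesis T_nodup : forall n, NoDup (T n).
Hypothesis T_weight : forall n, 1 <= lsum w (T n).
Hypothesis branch_weight_vanishes : forall x eps, branch T x -> 0 < eps ->
  exists n, lprod w (prefix x n) <= eps.
Hypothesis code_exists : forall x, branch T x -> exists z, E z /\ code x z.
Hypothesis code_separated : forall x y n z z' r,
  branch T x -> branch T y -> prefix y n = prefix x n -> y n <> x n ->
  code x z -> code y z' -> 0 < r -> Cmod (z - z') <= r ->
  lprod w (prefix x n) <= K * Rpower r s.

Definition meets (U : C -> Prop) (x : nat -> A) : Prop :=
  branch T x /\ exists z, code x z /\ U z.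

Lemma small_set_word U r : 0 < r -> diam_le U r -> (exists x, meets U x) ->
  exists p, lprod w p <= Rmax 1 K * Rpower r s /\
    forall x, meets U x -> prefix x (length p) = p.
Proof.
  intros Hr Hdiam [x Hx].
  assert (Hpow : 0 < Rpower r s) by apply exp_pos.
  destruct (first_divergence (meets U) x) as [Hsame|[n [y [Hy [Hneq Hprefix]]]]].
  - destruct (branch_weight_vanishes x (Rpower r s) (proj1 Hx) Hpow) as [n Hn].
    exists (prefix x n). split.
    + pose proof (Rmax_l 1 K). nra.
    + intros y Hy. rewrite prefix_length. apply Hsame, Hy.
  - exists (prefix x n). split.
    + destruct Hx as [Hx [z [Hz Uz]]]. destruct Hy as [Hy [z' [Hz' Uz']]].
      apply Rle_trans with (K * Rpower r s).
      * apply (code_separated x y n z z' r); auto. apply Hprefix.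
        split; [exact Hy|]. exists z'. auto.
      * apply Rmult_le_compat_r; [lra|apply Rmax_r].
    + intros y' Hy'. rewrite prefix_length. apply Hprefix, Hy'.
Qed.

(* A cover of small cost gives words of small total weight, hence a branch avoiding them
   all; but the point which it codes lies in a set of the cover. *)
Lemma hausdorff_measure_neq_0 : hausdorff_measure s E <> Finite 0.
Proof.
  intros Hzero. set (L := Rmax 1 K). pose proof (Rmax_l 1 K) as HL. fold L in HL.
  destruct (hausdorff_measure_0_cover E s 1 (/ (2 * L)) Rlt_0_1
    ltac:(apply Rinv_0_lt_compat; lra) Hzero) as [U [r [Hr [Hcover Hcost]]]].
  set (active := fun i => exists x, meets (U i) x).
  destruct (functional_choice (fun i p => active i ->
    lprod w p <= L * Rpower (r i) s /\
    forall x, meets (U i) x -> prefix x (length p) = p)) as [word Hword].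
  { intros i. destruct (classic (active i)) as [Hact|Hact].
    - destruct (Hr i) as [Hri Hdiam].
      destruct (small_set_word (U i) (r i) (proj1 Hri) Hdiam Hact) as [p Hp].
      exists p. auto.
    - exists nil. tauto. }
  destruct (avoiding_branch T w active word w_pos T_nodup T_weight (/ 2))
    as [x [Hx Havoid]]; [lra| |].
  - intros N.
    apply Rle_trans with
      (L * sum_f_R0 (fun i => value_if (exists z, U i z) (Rpower (r i) s)) N).
    + rewrite scal_sum. apply sum_Rle. intros i _.
      assert (Hri : 0 < Rpower (r i) s) by apply exp_pos.
      apply Rle_trans with (value_if (exists z, U i z) (L * Rpower (r i) s)).
      * apply value_if_le; [nra|]. intros Hact. split; [|apply (Hword i Hact)].
        destruct Hact as [y [_ [z [_ Uz]]]]. exists z. exact Uz.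
      * unfold value_if. destruct excluded_middle_informative; lra.
    + pose proof (cover_cost_partial U r s _ N Hcost) as Hpartial.
      apply (Rmult_lt_compat_l L) in Hpartial; [|lra].
      replace (L * / (2 * L)) with (/ 2) in Hpartial by (field; lra). lra.
  - destruct (code_exists x Hx) as [z [Ez Hz]]. destruct (Hcover z Ez) as [i Uz].
    assert (Hmeets : meets (U i) x) by (split; [exact Hx|exists z; auto]).
    assert (Hact : active i) by (exists x; exact Hmeets).
    exact (Havoid i Hact (proj2 (Hword i Hact) x Hmeets)).
Qed.

End MassDistribution.

Lemma hausdorff_dim_ge (E : C -> Prop) (d : R) :
  (forall s, 0 <= s -> s < d -> hausdorff_measure s E <> Finite 0) ->
  Rbar_le d (hausdorff_dim E).
Proof.
  intros Hpos. apply (Rbar_glb_correct _). intros x [s [Hs [-> Hzero]]]. simpl.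
  apply Rnot_lt_le. intros Hlt. exact (Hpos s Hs Hlt Hzero).
Qed.

(** * Functions with a pole *)

Definition comparable (K A B : R) : Prop := A <= K * B /\ B <= K * A.

Record polar (f : C -> C) (a : C) (m : nat) (K alpha r : R) : Prop := {
  polar_order : (1 <= m)%nat;
  polar_constant : 1 <= K;
  polar_scale : 0 < alpha;
  polar_limit : exists L : C, L <> RtoC 0 /\
    filterlim (fun z => (z - a) ^ m * f z)%C (locally' a) (locally L);
  polar_value : forall z, 0 < Cmod (z - a) < r ->
    comparable K alpha (Cmod (f z) * Cmod (z - a) ^ m);
  polar_derivative : forall z, 0 < Cmod (z - a) < r -> exists d, leading_term f z d 1 /\
    comparable K (INR m * alpha) (Cmod d * Cmod (z - a) ^ S m) }.

Arguments polar_order {f a m K alpha r} _.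
Arguments polar_constant {f a m K alpha r} _.
Arguments polar_scale {f a m K alpha r} _.
Arguments polar_limit {f a m K alpha r} _.
Arguments polar_value {f a m K alpha r} _ z _.
Arguments polar_derivative {f a m K alpha r} _ z _.

Definition recip_ext (f : C -> C) (a z : C) : C :=
  if excluded_middle_informative (z = a) then RtoC 0 else (/ f z)%C.

Lemma recip_ext_pole (f : C -> C) (a : C) : recip_ext f a a = RtoC 0.
Proof. unfold recip_ext. destruct excluded_middle_informative; tauto. Qed.

Lemma recip_ext_neq (f : C -> C) (a z : C) : z <> a -> recip_ext f a z = (/ f z)%C.
Proof. intros Hz. unfold recip_ext. destruct excluded_middle_informative; tauto. Qed.

Lemma recip_ext_leading_term (f : C -> C) (a L : C) (m : nat) :
  (1 <= m)%nat -> L <> RtoC 0 ->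
  filterlim (fun z => (z - a) ^ m * f z)%C (locally' a) (locally L) ->
  leading_term (recip_ext f a) a (/ L) m.
Proof.
  intros Hm HL Hlim eps Heps.
  pose proof (proj1 (continuous_Cmod Cinv L) (continuous_Cinv L HL) eps Heps) as Hinv.
  generalize (Hlim _ (filter_and _ _ (locally_neq 0 L HL) Hinv)).
  unfold filtermap, locally', within. apply filter_imp. intros y Hy. rewrite recip_ext_pole.
  destruct (classic (y = a)) as [->|Hya].
  { rewrite recip_ext_pole. replace (a - a)%C with (RtoC 0) by ring.
    destruct m as [|m]; [lia|].
    replace (0 - 0 - / L * 0 ^ S m)%C with (RtoC 0) by (simpl; ring).
    rewrite Cmod_0, pow_i by lia. lra. }
  rewrite recip_ext_neq by exact Hya.
  destruct (Hy Hya) as [Hq Hclose]. set (q := ((y - a) ^ m * f y)%C) in *.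
  change (q <> RtoC 0) in Hq.
  assert (Hpow : ((y - a) ^ m)%C <> RtoC 0).
  { intros Hzero. apply Hq. unfold q. rewrite Hzero. ring. }
  assert (Hf : f y <> RtoC 0).
  { intros Hzero. apply Hq. unfold q. rewrite Hzero. ring. }
  replace (/ f y - 0 - / L * (y - a) ^ m)%C with ((/ q - / L) * (y - a) ^ m)%C
    by (unfold q; field; auto).
  rewrite Cmod_mult, Cmod_pow.
  apply Rmult_le_compat_r; [apply pow_le, Cmod_ge_0|lra].
Qed.

Lemma pow_le_cancel (x y : R) (m : nat) :
  0 < y -> (1 <= m)%nat -> x ^ m <= y ^ m -> x <= y.
Proof.
  intros Hy Hm Hpow. apply Rnot_lt_le. intros Hlt.
  pose proof (lt_0_INR m ltac:(lia)) as HM.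
  pose proof (Rlt_Rpower_l y x (INR m) HM (conj Hy Hlt)) as Hstrict.
  rewrite !Rpower_pow in Hstrict; lra.
Qed.

Lemma pow_Rpower_root (x : R) (m : nat) : (1 <= m)%nat -> 0 < x ->
  Rpower x (/ INR m) ^ m = x.
Proof.
  intros Hm Hx. assert (HM : INR m <> 0) by (apply not_0_INR; lia).
  rewrite <- Rpower_pow by apply exp_pos.
  rewrite Rpower_mult, Rinv_l by exact HM. apply Rpower_1, Hx.
Qed.

Definition lift_const (K : R) (m : nat) : R := K ^ 2 * 2 ^ S m.

Lemma lift_const_pos (K : R) (m : nat) : 0 < K -> 0 < lift_const K m.
Proof. intros HK. apply Rmult_lt_0_compat; apply pow_lt; lra. Qed.

Section Polar.
Context {f : C -> C} {a : C} {m : nat} {K alpha r : R}.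
Hypothesis f_polar : polar f a m K alpha r.

Lemma polar_neq_0 z : 0 < Cmod (z - a) < r -> f z <> RtoC 0.
Proof.
  intros Hz Hzero. destruct (polar_value f_polar z Hz) as [Hlow _].
  pose proof (polar_scale f_polar).
  rewrite Hzero, Cmod_0 in Hlow. lra.
Qed.

Lemma polar_derivative_gt_0 z d : 0 < Cmod (z - a) < r ->
  comparable K (INR m * alpha) (Cmod d * Cmod (z - a) ^ S m) -> 0 < Cmod d.
Proof.
  intros Hz [Hlow _]. pose proof (polar_scale f_polar) as Halpha.
  assert (HM : 0 < INR m) by (apply lt_0_INR, (polar_order f_polar)).
  apply Cmod_gt_0. intros ->. rewrite Cmod_0 in Hlow. nra.
Qed.

Lemma polar_recip_leading_term x : Cmod (x - a) < r ->
  exists c k, (1 <= k)%nat /\ leading_term (recip_ext f a) x c k /\ 0 < Cmod c.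
Proof.
  intros Hx. destruct (classic (x = a)) as [->|Hxa].
  - destruct (polar_limit f_polar) as [L [HL Hlim]].
    pose proof (polar_order f_polar) as Hm.
    exists (/ L)%C, m. split; [exact Hm|]. split.
    + apply recip_ext_leading_term; assumption.
    + rewrite Cmod_inv by exact HL. apply Rinv_0_lt_compat, Cmod_gt_0, HL.
  - assert (Hx' : 0 < Cmod (x - a) < r) by (split; [apply Cmod_minus_gt_0|]; assumption).
    pose proof (polar_neq_0 x Hx') as Hfx.
    destruct (polar_derivative f_polar x Hx') as [d [Hd Hsize]].
    exists (- (d / (f x * f x)))%C, 1%nat. split; [lia|]. split.
    + apply (leading_term_ext_loc (fun y => / f y)%C).
      * generalize (locally_neq a x Hxa). apply filter_imp. intros y Hy.
        symmetry. apply recip_ext_neq, Hy.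
      * apply leading_term_inv; [lia|assumption|assumption].
    + pose proof (polar_derivative_gt_0 x d Hx' Hsize) as Hdpos.
      pose proof (proj1 (Cmod_gt_0 _) Hfx) as Hfpos.
      rewrite Cmod_opp, Cmod_div, Cmod_mult by (apply Cmult_neq_0; assumption).
      apply Rdiv_lt_0_compat; [|apply Rmult_lt_0_compat]; assumption.
Qed.

Lemma polar_inv_boundary_far v x del : Cmod (x - a) = del -> 0 < del -> del < r ->
  2 * K * alpha < Cmod v * del ^ m -> Cmod (/ v) < Cmod (/ f x - / v).
Proof.
  intros Hx Hdel Hdel_r Hlarge.
  assert (Hxr : 0 < Cmod (x - a) < r) by lra.
  pose proof (polar_neq_0 x Hxr) as Hfx.
  destruct (polar_value f_polar x Hxr) as [_ Hup]. rewrite Hx in Hup.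
  assert (Hpow : 0 < del ^ m) by (apply pow_lt, Hdel).
  assert (Hfv : 2 * Cmod (f x) < Cmod v).
  { apply Rmult_lt_reg_r with (del ^ m); [exact Hpow|]. lra. }
  pose proof (proj1 (Cmod_gt_0 _) Hfx) as Hfpos.
  assert (Hv : v <> RtoC 0) by (apply Cmod_gt_0; lra).
  pose proof (Cmod_minus_ge (/ f x) (/ v)) as Htri.
  enough (2 * Cmod (/ v) < Cmod (/ f x)) by lra.
  rewrite !Cmod_inv by assumption.
  apply Rmult_lt_reg_r with (Cmod (f x) * Cmod v); [apply Rmult_lt_0_compat; lra|].
  replace (2 * / Cmod v * (Cmod (f x) * Cmod v)) with (2 * Cmod (f x)) by (field; lra).
  replace (/ Cmod (f x) * (Cmod (f x) * Cmod v)) with (Cmod v) by (field; lra).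
  exact Hfv.
Qed.

Lemma polar_attains_value v del : 0 < del -> del < r ->
  2 * K * alpha < Cmod v * del ^ m -> exists z, 0 < Cmod (z - a) < del /\ f z = v.
Proof.
  intros Hdel Hdel_r Hlarge.
  pose proof (polar_scale f_polar) as Halpha.
  pose proof (polar_constant f_polar) as HK.
  assert (Hv : v <> RtoC 0).
  { intros ->. rewrite Cmod_0 in Hlarge. nra. }
  assert (Hcenter : Cmod (recip_ext f a a - / v) = Cmod (/ v)).
  { rewrite recip_ext_pole, <- Cmod_opp. f_equal. ring. }
  destruct (descent_attains_value (recip_ext f a) a (/ v) del 0) as [x [Hx [Hval _]]].
  - lra.
  - apply Rle_refl.
  - intros x Hx. destruct (polar_recip_leading_term x ltac:(lra)) as [c [k [Hk [Hlead _]]]].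
    exact (leading_term_continuous _ _ _ _ Hk Hlead).
  - intros x Hx. rewrite Hcenter, recip_ext_neq by (apply Cmod_minus_gt_0; lra).
    rewrite Rmult_0_l, Rplus_0_r. apply (polar_inv_boundary_far v x del); assumption.
  - intros x e Hx Hneq He.
    destruct (polar_recip_leading_term x ltac:(lra)) as [c [k [Hk [Hlead Hc]]]].
    destruct (leading_term_descent _ x c (/ v) k 0 e Hk Hlead ltac:(lra) Hneq He)
      as [y [Hy Hless]].
    exists y. split; [exact Hy|]. lra.
  - assert (Hxa : x <> a).
    { intros ->. rewrite recip_ext_pole in Hval. apply Hv.
      rewrite <- (Cmult_1_r v), <- (Cinv_r v Hv), <- Hval. ring. }
    pose proof (proj1 (Cmod_minus_gt_0 _ _) Hxa) as Hpos.
    exists x. split; [lra|]. rewrite recip_ext_neq in Hval by exact Hxa.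
    pose proof (polar_neq_0 x ltac:(lra)) as Hfx.
    replace (f x) with (/ / f x)%C by (field; exact Hfx). rewrite Hval. field. exact Hv.
Qed.

Lemma polar_derivative_lower x z d : 0 < Cmod (z - a) < r -> 0 < Cmod (x - a) < r ->
  Cmod (x - a) < 2 * Cmod (z - a) ->
  comparable K (INR m * alpha) (Cmod d * Cmod (x - a) ^ S m) ->
  Cmod (f z) < lift_const K m * Cmod (z - a) * Cmod d.
Proof.
  intros Hz Hx Hxz Hsize. set (s := Cmod (z - a)) in *.
  pose proof (polar_constant f_polar) as HK.
  pose proof (polar_scale f_polar) as Halpha.
  assert (HM : 1 <= INR m) by (apply (le_INR 1), (polar_order f_polar)).
  pose proof (polar_derivative_gt_0 x d Hx Hsize) as Hd.
  destruct Hsize as [Hlow _].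
  destruct (polar_value f_polar z Hz) as [_ Hup]. fold s in Hup.
  assert (Hpow : Cmod (x - a) ^ S m < (2 * s) ^ S m).
  { apply Rnot_le_lt. intros Hle. apply pow_le_cancel in Hle; [lra|lra|lia]. }
  assert (Hsm : 0 < s ^ m) by (apply pow_lt; lra).
  apply Rmult_lt_reg_r with (s ^ m); [exact Hsm|].
  apply Rle_lt_trans with (K * alpha); [exact Hup|].
  apply Rlt_le_trans with (K * (K * (Cmod d * (2 * s) ^ S m))).
  - apply Rmult_lt_compat_l; [lra|].
    apply Rle_lt_trans with (K * (Cmod d * Cmod (x - a) ^ S m)); [nra|].
    apply Rmult_lt_compat_l; [lra|]. apply Rmult_lt_compat_l; assumption.
  - rewrite Rpow_mult_distr. apply Req_le. unfold lift_const. simpl. ring.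
Qed.

Lemma polar_lift z v : 0 < Cmod (z - a) -> 3 / 2 * Cmod (z - a) < r ->
  2 * lift_const K m * Cmod (f z - v) < Cmod (f z) ->
  exists x, Cmod (x - z) < Cmod (z - a) / 2 /\ f x = v /\
    Cmod (f z) * Cmod (x - z) <= lift_const K m * Cmod (z - a) * Cmod (f z - v).
Proof.
  intros Hz Hzr Hv. set (Q := lift_const K m) in *. set (s := Cmod (z - a)) in *.
  pose proof (polar_constant f_polar) as HK.
  pose proof (lift_const_pos K m ltac:(lra) : 0 < Q) as HQ.
  assert (Hfz : 0 < Cmod (f z)) by (pose proof (Cmod_ge_0 (f z - v)); nra).
  assert (HQs : 0 < Q * s) by (apply Rmult_lt_0_compat; assumption).
  set (lam := Cmod (f z) / (Q * s)).
  assert (Hlam : 0 < lam) by (apply Rdiv_lt_0_compat; assumption).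
  assert (Hfz_lam : Cmod (f z) = lam * (Q * s)) by (unfold lam; field; lra).
  assert (Hsteep : forall x, Cmod (x - z) <= s / 2 ->
    exists d, leading_term f x d 1 /\ lam < Cmod d).
  { intros x Hx.
    pose proof (Cmod_minus_triangle x z a) as Hfar. fold s in Hfar.
    pose proof (Cmod_minus_triangle z x a) as Hnear. rewrite (Cmod_minus_sym z x) in Hnear.
    fold s in Hnear.
    assert (Hxa : 0 < Cmod (x - a) < r) by lra.
    destruct (polar_derivative f_polar x Hxa) as [d [Hd Hsize]].
    exists d. split; [exact Hd|].
    pose proof (polar_derivative_lower x z d ltac:(fold s; lra) Hxa
      ltac:(fold s; lra) Hsize) as Hlow. fold s Q in Hlow.
    apply Rmult_lt_reg_r with (Q * s); [exact HQs|]. lra. }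
  assert (Hgap : Cmod (f z - v) < lam * (s / 2)) by nra.
  destruct (descent_attains_value f z v (s / 2) lam) as [x [Hx [Hval Hdist]]]; try lra.
  - intros x Hx. destruct (Hsteep x Hx) as [d [Hd _]].
    exact (leading_term_continuous f x d 1 (le_n 1) Hd).
  - intros x _. pose proof (Cmod_ge_0 (f x - v)). lra.
  - intros x del Hx Hneq Hdel. destruct (Hsteep x ltac:(lra)) as [d [Hd Hlow]].
    destruct (leading_term_descent f x d v 1 lam del (le_n 1) Hd ltac:(lra) Hneq Hdel)
      as [y Hy].
    exists y. rewrite pow_1 in Hy. exact Hy.
  - exists x. split; [exact Hx|]. split; [exact Hval|].
    rewrite Hfz_lam. apply (Rmult_le_compat_l (Q * s)) in Hdist; lra.
Qed.

Lemma polar_derivative_upper z d rho : 0 < rho -> rho / 2 <= Cmod (z - a) ->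
  comparable K (INR m * alpha) (Cmod d * Cmod (z - a) ^ S m) ->
  Cmod d <= K * INR m * 2 ^ S m * alpha / rho ^ S m.
Proof.
  intros Hrho Hz [_ Hup].
  assert (Hpow : 0 < rho ^ S m) by (apply pow_lt, Hrho).
  assert (Htwo : 0 < 2 ^ S m) by (apply pow_lt; lra).
  assert (Hle : rho ^ S m <= 2 ^ S m * Cmod (z - a) ^ S m).
  { rewrite <- Rpow_mult_distr. apply pow_incr. lra. }
  apply Rle_div_r; [exact Hpow|].
  apply Rle_trans with (Cmod d * (2 ^ S m * Cmod (z - a) ^ S m)).
  - apply Rmult_le_compat_l; [apply Cmod_ge_0|exact Hle].
  - nra.
Qed.

Lemma polar_far z B : 0 < Cmod (z - a) < r -> Cmod (f z) <= B -> 0 < B ->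
  Rpower (alpha / (K * B)) (/ INR m) <= Cmod (z - a).
Proof.
  intros Hz HB HBpos.
  pose proof (polar_order f_polar) as Hm.
  pose proof (polar_constant f_polar) as HK.
  pose proof (polar_scale f_polar) as Halpha.
  assert (HKB : 0 < K * B) by (apply Rmult_lt_0_compat; lra).
  apply (pow_le_cancel _ _ m); [lra|exact Hm|].
  rewrite pow_Rpower_root by (try apply Rdiv_lt_0_compat; assumption).
  destruct (polar_value f_polar z Hz) as [Hlow _].
  pose proof (pow_lt _ m (proj1 Hz)) as Hpow.
  apply Rle_div_l; [exact HKB|].
  assert (Cmod (f z) * Cmod (z - a) ^ m <= B * Cmod (z - a) ^ m)
    by (apply Rmult_le_compat_r; lra).
  nra.
Qed.

Lemma polar_local_lipschitz x y rho : 0 < rho ->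
  0 < Cmod (x - a) < r -> 0 < Cmod (y - a) < r ->
  rho <= Cmod (x - a) -> Cmod (y - x) < rho / 2 ->
  Cmod (f y - f x) <= K * INR m * 2 ^ S m * alpha / rho ^ S m * Cmod (y - x).
Proof.
  intros Hrho Hx Hy Hfar Hclose. apply Cmod_mean_value. intros t Ht.
  set (p := (x + RtoC t * (y - x))%C).
  assert (Hpx : Cmod (p - x) < rho / 2).
  { replace (p - x)%C with (RtoC t * (y - x))%C by (unfold p; ring).
    rewrite Cmod_scal by lra. pose proof (Cmod_ge_0 (y - x)). nra. }
  assert (Hpr : Cmod (p - a) < r).
  { replace (p - a)%C with (RtoC (1 - t) * (x - a) + RtoC t * (y - a))%C
      by (unfold p; rewrite RtoC_minus; ring).
    eapply Rle_lt_trans; [apply Cmod_triangle|]. rewrite !Cmod_scal by lra.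
    destruct (Req_dec t 0) as [->|Ht0]; [lra|nra]. }
  assert (Hpa : rho / 2 <= Cmod (p - a)).
  { pose proof (Cmod_minus_triangle x p a) as Htri. rewrite (Cmod_minus_sym x p) in Htri.
    lra. }
  destruct (polar_derivative f_polar p ltac:(lra)) as [d [Hd Hsize]].
  exists d. split; [exact Hd|].
  apply (polar_derivative_upper p); assumption.
Qed.

(* The bound [|f| <= B] keeps [x] and [y] at distance [rho] from [a]; if they are at least
   [rho / 2] apart, the trivial bound [2 B] suffices. *)
Lemma polar_lipschitz x y B :
  0 < Cmod (x - a) < r -> 0 < Cmod (y - a) < r ->
  Cmod (f x) <= B -> Cmod (f y) <= B -> 0 < B ->
  Cmod (f y - f x) <=
    K ^ 2 * INR m * 2 ^ S m * B * Rpower (K * B / alpha) (/ INR m) * Cmod (y - x).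
Proof.
  intros Hx Hy HBx HBy HB.
  pose proof (polar_order f_polar) as Hm.
  pose proof (polar_constant f_polar) as HK.
  pose proof (polar_scale f_polar) as Halpha.
  assert (HKB : 0 < K * B) by (apply Rmult_lt_0_compat; lra).
  set (rho := Rpower (alpha / (K * B)) (/ INR m)).
  assert (Hrho : 0 < rho) by apply exp_pos.
  assert (Hrho_pow : rho ^ m = alpha / (K * B)).
  { apply pow_Rpower_root; [exact Hm|]. apply Rdiv_lt_0_compat; assumption. }
  assert (Hinv : Rpower (K * B / alpha) (/ INR m) = / rho).
  { unfold rho, Rpower. rewrite <- exp_Ropp. f_equal.
    rewrite !ln_div by assumption. ring. }
  rewrite Hinv. pose proof (polar_far x B Hx HBx HB) as Hfar. fold rho in Hfar.
  destruct (Rlt_le_dec (Cmod (y - x)) (rho / 2)) as [Hclose|Hapart].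
  - eapply Rle_trans; [apply (polar_local_lipschitz x y rho); assumption|].
    apply Req_le. simpl (rho ^ S m). rewrite Hrho_pow. field. lra.
  - assert (HM : 1 <= INR m) by (apply (le_INR 1), Hm).
    assert (Htwo : 4 <= 2 ^ S m).
    { replace 4 with (2 ^ 2) by ring. apply Rle_pow; [lra|lia]. }
    assert (Hconst : 4 <= K ^ 2 * INR m * 2 ^ S m).
    { assert (1 <= K ^ 2 * INR m) by nra. nra. }
    apply Rle_trans with (2 * B); [pose proof (Cmod_minus_le (f y) (f x)); lra|].
    apply Rle_trans with (4 * (B * / rho * (rho / 2))); [apply Req_le; field; lra|].
    assert (HBrho : 0 < B * / rho).
    { apply Rmult_lt_0_compat; [|apply Rinv_0_lt_compat]; assumption. }
    apply Rle_trans with (K ^ 2 * INR m * 2 ^ S m * (B * / rho * Cmod (y - x)));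
      [|apply Req_le; ring].
    apply Rmult_le_compat; [lra|nra|exact Hconst|].
    apply Rmult_le_compat_l; lra.
Qed.

End Polar.

Lemma comparable_of_quotient (K A p X : R) : 0 < K -> 0 < p ->
  / K * (A / p) <= X <= K * (A / p) -> comparable K A (X * p).
Proof.
  intros HK Hp [Hlow Hup]. split.
  - apply (Rmult_le_compat_r (K * p)) in Hlow; [|nra].
    replace (/ K * (A / p) * (K * p)) with A in Hlow by (field; lra). lra.
  - apply (Rmult_le_compat_r p) in Hup; [|lra].
    replace (K * (A / p) * p) with (K * A) in Hup by (field; lra). exact Hup.
Qed.

Definition pole_estimates (f0 : C -> Chat) (a : C) (m : nat) (K beta r : R) : Prop :=
  forall z, 0 < Cmod (z - a) < r ->
    let A := Rpower (Cmod a) (- beta) * Rpower (Cmod (z - a)) (- INR m) in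
    / K * A <= Cmod (fin f0 z) <= K * A /\
    forall d, cderiv (fin f0) z d ->
      / K * (INR m * A / Cmod (z - a)) <= Cmod d <= K * (INR m * A / Cmod (z - a)).

Lemma pole_estimates_polar (f0 : C -> Chat) (a : C) (m : nat) (K beta r : R) :
  meromorphic f0 -> 1 <= K -> pole_mult f0 a m ->
  (forall z, 0 < Cmod (z - a) < r -> f0 z <> None) ->
  pole_estimates f0 a m K beta r ->
  polar (fin f0) a m K (Rpower (Cmod a) (- beta)) r.
Proof.
  intros [_ [Hmero _]] HK [_ [Hm [L [HL Hlim]]]] Hdef Hest.
  assert (Hpow : forall z, 0 < Cmod (z - a) ->
    Rpower (Cmod (z - a)) (- INR m) = / Cmod (z - a) ^ m).
  { intros z Hz. rewrite Rpower_Ropp, Rpower_pow by exact Hz. reflexivity. }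
  constructor; [exact Hm|exact HK|apply exp_pos| | |].
  - exists L. split; [exact HL|]. intros P HP. apply locally_disc in HP.
    destruct HP as [eps [Heps HP]]. destruct (Hlim eps Heps) as [del [Hdel Hclose]].
    apply locally_disc. exists del. split; [exact Hdel|]. intros z Hz Hneq.
    apply HP. rewrite <- Cpow_pow_n. apply Hclose.
    split; [apply Cmod_minus_gt_0, Hneq|exact Hz].
  - intros z Hz. destruct (Hest z Hz) as [Hval _]. rewrite Hpow in Hval by lra.
    apply comparable_of_quotient; [lra|apply pow_lt, Hz|exact Hval].
  - intros z Hz. destruct (Hmero z (Hdef z Hz)) as [d Hd].
    exists d. split; [exact (cderiv_leading_term _ _ _ Hd)|].
    destruct (Hest z Hz) as [_ Hder]. specialize (Hder d Hd). rewrite Hpow in Hder by lra.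
    apply comparable_of_quotient; [lra|apply pow_lt, Hz|].
    replace (INR m * Rpower (Cmod a) (- beta) / Cmod (z - a) ^ S m)
      with (INR m * (Rpower (Cmod a) (- beta) * / Cmod (z - a) ^ m) / Cmod (z - a)).
    + exact Hder.
    + simpl. field. split; [apply pow_nonzero|]; lra.
Qed.

(** * Orbits following a sequence of poles *)

Lemma fin_Some (f : C -> Chat) (z v : C) : f z = Some v -> fin f z = v.
Proof. intros Hz. unfold fin. rewrite Hz. reflexivity. Qed.

Lemma Some_fin (f : C -> Chat) (z : C) : f z <> None -> f z = Some (fin f z).
Proof. intros Hz. unfold fin. destruct (f z); [reflexivity|tauto]. Qed.

Lemma Fit_S (f0 : C -> Chat) (c : nat -> C) (n : nat) (z w : C) :
  Fit f0 c n z = Some w -> f0 w <> None ->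
  Fit f0 c (S n) z = Some (fin f0 w + c (S n))%C.
Proof. intros Hz Hw. simpl. rewrite Hz, (Some_fin f0 w Hw). reflexivity. Qed.

Lemma Fit_S_inv (f0 : C -> Chat) (c : nat -> C) (n : nat) (z v : C) :
  Fit f0 c (S n) z = Some v ->
  exists w, Fit f0 c n z = Some w /\ f0 w <> None /\ v = (fin f0 w + c (S n))%C.
Proof.
  simpl. destruct (Fit f0 c n z) as [w|]; [|discriminate].
  destruct (f0 w) as [u|] eqn:Hw; [|discriminate].
  intros Hv. injection Hv as <-. exists w. rewrite (fin_Some _ _ _ Hw).
  repeat split; congruence.
Qed.

Definition Fit_continuous (f0 : C -> Chat) (c : nat -> C) (n : nat) (z v : C) : Prop :=
  Fit f0 c n z = Some v /\
  forall P, locally v P -> locally z (fun y => exists v', Fit f0 c n y = Some v' /\ P v').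

Lemma Fit_continuous_0 (f0 : C -> Chat) (c : nat -> C) (z : C) :
  Fit_continuous f0 c 0 z z.
Proof.
  split; [reflexivity|]. intros P. apply filter_imp. intros y Hy. exists y. auto.
Qed.

Lemma Fit_continuous_S (f0 : C -> Chat) (c : nat -> C) (n : nat) (z v : C) :
  Fit_continuous f0 c n z v -> locally v (fun y => f0 y <> None) ->
  continuous (fin f0) v -> Fit_continuous f0 c (S n) z (fin f0 v + c (S n))%C.
Proof.
  intros [Hz Hcont] Hdef Hf. split.
  - apply Fit_S; [exact Hz|]. exact (locally_singleton _ _ Hdef).
  - intros P HP.
    assert (Hshift : continuous (fun y => fin f0 y + c (S n))%C v).
    { apply (continuous_plus (fin f0) (fun _ => c (S n)) v Hf), continuous_const. }
    generalize (Hcont _ (filter_and _ _ Hdef (Hshift P HP))). apply filter_imp.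
    intros y [v' [Hy [Hv' HPv']]]. exists (fin f0 v' + c (S n))%C.
    split; [apply Fit_S; assumption|exact HPv'].
Qed.

Lemma Fit_continuous_cluster_point (f0 : C -> Chat) (c : nat -> C) (n : nat) (z v : C)
  (u : nat -> C) (P Q : C -> Prop) :
  Fit_continuous f0 c n z v -> cluster_point u z -> locally v P ->
  eventually (fun k => exists v', Fit f0 c n (u k) = Some v' /\ Q v') ->
  exists v', P v' /\ Q v'.
Proof.
  intros [_ Hcont] Hu HP [N HN].
  destruct (Hu _ (Hcont P HP) N) as [k [Hk [v' [Hv' HPv']]]].
  destruct (HN k Hk) as [v'' [Hv'' HQ]]. exists v'. split; [exact HPv'|]. congruence.
Qed.

Definition visits (f0 : C -> Chat) (c : nat -> C) (del : R) (w : nat -> C) (z : C)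
  (k : nat) : Prop :=
  exists v, Fit f0 c k z = Some v /\ Cmod (v - w k) <= del.

Definition itinerary (f0 : C -> Chat) (c : nat -> C) (del : R) (w : nat -> C) (z : C) :
  Prop := forall k, visits f0 c del w z k.

Definition lip_const (K : R) (m : nat) : R :=
  K ^ 2 * INR m * 2 ^ S m * 2 * Rpower (2 * K) (/ INR m).

Definition pole_threshold (K : R) (m : nat) (del : R) : R :=
  4 + 4 * K / del ^ m + 4 * lift_const K m.

Record large_pole (f0 : C -> Chat) (m : nat) (K beta del : R) (a : C) : Prop := {
  large_pole_is_pole : is_pole f0 a;
  large_pole_polar : polar (fin f0) a m K (Rpower (Cmod a) (- beta)) (4 * del);
  large_pole_isolated : forall z, 0 < Cmod (z - a) < 4 * del -> f0 z <> None;
  large_pole_size : pole_threshold K m del <= Cmod a }.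

Arguments large_pole_is_pole {f0 m K beta del a} _.
Arguments large_pole_polar {f0 m K beta del a} _.
Arguments large_pole_isolated {f0 m K beta del a} _ z _.
Arguments large_pole_size {f0 m K beta del a} _.

Definition expansion_exponent (m : nat) (beta : R) : R := 1 + / INR m + beta / INR m.

Definition expansion (K : R) (m : nat) (beta : R) (a : C) : R :=
  lip_const K m * Rpower (Cmod a) (expansion_exponent m beta).

Lemma pow_small (q eps : R) : 0 <= q < 1 -> 0 < eps -> exists n, q ^ n < eps.
Proof.
  intros Hq Heps.
  destruct (pow_lt_1_zero q ltac:(rewrite Rabs_pos_eq; lra) eps Heps) as [n Hn].
  exists n. eapply Rle_lt_trans; [apply Rle_abs|]. apply Hn, Nat.le_refl.
Qed.

Lemma Rpower_ge_1 (x e : R) : 1 <= x -> 0 <= e -> 1 <= Rpower x e.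
Proof.
  intros Hx He. rewrite <- (Rpower_O x) by lra. apply Rle_Rpower; assumption.
Qed.

Lemma lip_const_ge_1 (K : R) (m : nat) : (1 <= m)%nat -> 1 <= K -> 1 <= lip_const K m.
Proof.
  intros Hm HK. unfold lip_const.
  assert (HM : 1 <= INR m) by (apply (le_INR 1), Hm).
  assert (Htwo : 1 <= 2 ^ S m) by (apply pow_R1_Rle; lra).
  assert (Hroot : 1 <= Rpower (2 * K) (/ INR m)).
  { apply Rpower_ge_1; [lra|]. apply Rlt_le, Rinv_0_lt_compat. lra. }
  assert (HKM : 1 <= K ^ 2 * INR m) by nra.
  assert (HKM2 : 1 <= K ^ 2 * INR m * 2 ^ S m) by nra. nra.
Qed.

Section LargePole.
Context {f0 : C -> Chat} {m : nat} {K beta del : R} {a : C}.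
Hypothesis del_pos : 0 < del.
Hypothesis a_large : large_pole f0 m K beta del a.

Lemma large_pole_order : (1 <= m)%nat.
Proof. exact (polar_order (large_pole_polar a_large)). Qed.

Lemma large_pole_constant : 1 <= K.
Proof. exact (polar_constant (large_pole_polar a_large)). Qed.

Lemma large_pole_bounds :
  4 <= Cmod a /\ 4 * K < Cmod a * del ^ m /\ 4 * lift_const K m < Cmod a.
Proof.
  pose proof (large_pole_size a_large) as Hsize.
  pose proof large_pole_constant as HK.
  assert (Hpow : 0 < del ^ m) by (apply pow_lt, del_pos).
  pose proof (lift_const_pos K m ltac:(lra)) as HQ.
  assert (Hquot : 0 < 4 * K / del ^ m) by (apply Rdiv_lt_0_compat; lra).
  unfold pole_threshold in Hsize. repeat split; try lra.
  apply Rlt_div_l; [exact Hpow|lra].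
Qed.

Lemma large_pole_continuous v : v <> a -> Cmod (v - a) < 4 * del ->
  locally v (fun y => f0 y <> None) /\ continuous (fin f0) v.
Proof.
  intros Hneq Hdist. split.
  - generalize (filter_and _ _ (locally_neq a v Hneq) (locally_open_disc a v _ Hdist)).
    apply filter_imp. intros y [Hy Hy_dist].
    apply (large_pole_isolated a_large).
    split; [apply Cmod_minus_gt_0|]; assumption.
  - apply Cmod_minus_gt_0 in Hneq.
    destruct (polar_derivative (large_pole_polar a_large) v (conj Hneq Hdist))
      as [d [Hd _]].
    exact (leading_term_continuous _ _ _ _ (le_n 1) Hd).
Qed.

Lemma large_pole_lipschitz B x y : 0 < B ->
  0 < Cmod (x - a) < 4 * del -> 0 < Cmod (y - a) < 4 * del ->
  Cmod (fin f0 x) <= 2 * B -> Cmod (fin f0 y) <= 2 * B ->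
  Cmod (fin f0 y - fin f0 x) <=
    lip_const K m * Rpower B (1 + / INR m) * Rpower (Cmod a) (beta / INR m) * Cmod (y - x).
Proof.
  intros HB Hx Hy HBx HBy.
  pose proof large_pole_constant as HK.
  eapply Rle_trans.
  { apply (polar_lipschitz (large_pole_polar a_large) x y (2 * B)); auto; lra. }
  apply Req_le.
  replace (K * (2 * B) / Rpower (Cmod a) (- beta))
    with (2 * K * B * Rpower (Cmod a) beta)
    by (rewrite Rpower_Ropp; field; apply Rgt_not_eq, exp_pos).
  unfold lip_const.
  rewrite <- !Rpower_mult_distr by (try apply exp_pos; repeat apply Rmult_lt_0_compat; lra).
  rewrite Rpower_mult, Rpower_plus, Rpower_1 by exact HB. unfold Rdiv. ring.
Qed.

End LargePole.

Section Orbits.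
Context {f0 : C -> Chat} {c : nat -> C} {m : nat} {K beta del : R}.
Hypothesis del_bounds : 0 < del <= 1.
Hypothesis c_small : forall n, Cmod (c n) < del.

Notation pole := (large_pole f0 m K beta del).
Notation visiting := (visits f0 c del).
Notation pole_sequence w := (forall k, pole (w k)).

Lemma large_pole_ge_4 a : pole a -> 4 <= Cmod a.
Proof. intros Ha. apply (large_pole_bounds (proj1 del_bounds) Ha). Qed.

Lemma orbit_value_bounds a y n : pole a -> Cmod (y - a) <= del ->
  Cmod a / 2 <= Cmod (y - c n) <= 2 * Cmod a.
Proof.
  intros Ha Hy. pose proof (large_pole_ge_4 a Ha) as Hsize. pose proof (c_small n) as Hcn.
  pose proof (Cmod_minus_le y (c n)). pose proof (Cmod_minus_ge y (c n)).
  pose proof (Cmod_minus_ge y a). pose proof (Cmod_minus_ge a y) as Hback.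
  rewrite Cmod_minus_sym in Hback. lra.
Qed.

Lemma visits_value_bounds w n z v : pole (w n) -> pole (w (S n)) ->
  visiting w z n -> visiting w z (S n) -> Fit f0 c n z = Some v ->
  0 < Cmod (v - w n) <= del /\
  Cmod (w (S n)) / 2 <= Cmod (fin f0 v) <= 2 * Cmod (w (S n)).
Proof.
  intros Hpole Hpole_S [v0 [Ev0 Hv0]] [v1 [Ev1 Hv1]] Ev.
  rewrite Ev in Ev0. injection Ev0 as <-.
  destruct (Fit_S_inv _ _ _ _ _ Ev1) as [v' [Ev' [Hdef ->]]].
  rewrite Ev in Ev'. injection Ev' as <-.
  pose proof (orbit_value_bounds _ _ (S n) Hpole_S Hv1) as Hbounds.
  replace (fin f0 v + c (S n) - c (S n))%C with (fin f0 v) in Hbounds by ring.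
  split; [split; [|exact Hv0]|exact Hbounds].
  apply Cmod_minus_gt_0. intros ->.
  exact (Hdef (large_pole_is_pole Hpole)).
Qed.

Lemma preimage_near_pole a b y n : 0 <= beta -> pole a -> pole b ->
  Cmod (y - b) <= del ->
  exists x, 0 < Cmod (x - a) < del /\ (fin f0 x + c n)%C = y.
Proof.
  intros Hbeta Ha Hb Hy.
  pose proof (large_pole_polar Ha) as Hpolar.
  pose proof (orbit_value_bounds b y n Hb Hy) as [Hval _].
  destruct (large_pole_bounds (proj1 del_bounds) Hb) as [_ [Hlarge _]].
  pose proof (large_pole_constant Ha) as HK.
  assert (Halpha : Rpower (Cmod a) (- beta) <= 1).
  { rewrite Rpower_Ropp, <- Rinv_1. pose proof (large_pole_ge_4 a Ha).
    apply Rinv_le_contravar; [lra|]. apply Rpower_ge_1; lra. }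
  assert (Hpow : 0 < del ^ m) by (apply pow_lt, del_bounds).
  destruct (polar_attains_value Hpolar (y - c n)%C del) as [x [Hx Hfx]]; try lra.
  { apply Rle_lt_trans with (2 * K); [nra|].
    apply Rlt_le_trans with (Cmod b / 2 * del ^ m); [lra|].
    apply Rmult_le_compat_r; lra. }
  exists x. split; [exact Hx|]. rewrite Hfx. ring.
Qed.

Lemma finite_itinerary_exists w n y : 0 <= beta -> pole_sequence w ->
  Cmod (y - w n) <= del ->
  exists z, Fit f0 c n z = Some y /\ forall k, (k <= n)%nat -> visiting w z k.
Proof.
  intros Hbeta Hw. revert y. induction n as [|n IH]; intros y Hy.
  - exists y. split; [reflexivity|]. intros k Hk. replace k with O by lia.
    exists y. split; [reflexivity|exact Hy].
  - destruct (preimage_near_pole (w n) (w (S n)) y (S n) Hbeta (Hw n) (Hw (S n)) Hy)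
      as [x [Hx Hfx]].
    destruct (IH x) as [z [Hz Hvisits]]; [lra|].
    assert (HzS : Fit f0 c (S n) z = Some y).
    { rewrite (Fit_S f0 c n z x Hz); [rewrite Hfx; reflexivity|].
      apply (large_pole_isolated (Hw n)). lra. }
    exists z. split; [exact HzS|]. intros k Hk.
    destruct (Nat.eq_dec k (S n)) as [->|Hneq]; [exists y; auto|]. apply Hvisits. lia.
Qed.

Lemma Fit_limit_in_disc u w z k v :
  Fit_continuous f0 c k z v -> cluster_point u z ->
  eventually (fun n => visiting w (u n) k) -> Cmod (v - w k) <= del.
Proof.
  intros Hcont Hu Hvisits. apply Rnot_lt_le. intros Hlt.
  destruct (Fit_continuous_cluster_point f0 c k z v u
    (fun y => Cmod (y - v) < Cmod (v - w k) - del) (fun y => Cmod (y - w k) <= del)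
    Hcont Hu ltac:(apply locally_near; lra) Hvisits) as [v' [Hclose Hdisc]].
  pose proof (Cmod_minus_triangle v v' (w k)) as Htri.
  rewrite (Cmod_minus_sym v v') in Htri. lra.
Qed.

(* The orbits keep a definite distance from the pole [w k], as their next points are
   close to [w (S k)]. *)
Lemma Fit_limit_not_pole u w z k v : pole (w k) -> pole (w (S k)) ->
  Fit_continuous f0 c k z v -> cluster_point u z ->
  eventually (fun n => visiting w (u n) k /\ visiting w (u n) (S k)) -> v <> w k.
Proof.
  intros Hpole Hpole_S Hcont Hu [N HN] ->.
  pose proof (large_pole_ge_4 _ Hpole_S) as Hsize.
  set (gap := Rpower (Rpower (Cmod (w k)) (- beta) / (K * (2 * Cmod (w (S k)))))
    (/ INR m)).
  destruct (Fit_continuous_cluster_point f0 c k z (w k) u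
    (fun y => Cmod (y - w k) < gap) (fun y => gap <= Cmod (y - w k)))
    as [v' [Hclose Hfar]]; [exact Hcont|exact Hu|apply locally_near, exp_pos| |lra].
  exists N. intros n Hn. destruct (HN n Hn) as [Hk HSk].
  destruct Hk as [v' [Ev' Hv']].
  destruct (visits_value_bounds w k (u n) v' Hpole Hpole_S) as [Hdist Hvalue];
    [exists v'; auto|exact HSk|exact Ev'|].
  exists v'. split; [exact Ev'|].
  apply (polar_far (large_pole_polar Hpole)); lra.
Qed.

Lemma itinerary_exists w : 0 <= beta -> pole_sequence w ->
  exists z, itinerary f0 c del w z.
Proof.
  intros Hbeta Hw.
  destruct (functional_choice (fun n z => forall k, (k <= n)%nat -> visiting w z k))
    as [u Hu].
  { intros n. destruct (finite_itinerary_exists w n (w n) Hbeta Hw) as [z [_ Hz]].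
    - rewrite Cmod_minus_diag. lra.
    - exists z. exact Hz. }
  destruct (bounded_cluster_point u (Cmod (w O) + del)) as [z Hz].
  { intros n. destruct (Hu n O ltac:(lia)) as [v [Ev Hv]]. injection Ev as <-.
    pose proof (Cmod_minus_ge (u n) (w O)). lra. }
  assert (Hvisits : forall k, eventually (fun n => visiting w (u n) k)).
  { intros k. exists k. intros n Hn. apply Hu, Hn. }
  assert (Hcont : forall k, exists v, Fit_continuous f0 c k z v).
  { induction k as [|k [v Hv]]; [exists z; apply Fit_continuous_0|].
    pose proof (Fit_limit_in_disc u w z k v Hv Hz (Hvisits k)) as Hdisc.
    assert (Hneq : v <> w k).
    { apply (Fit_limit_not_pole u w z k v); auto.
      apply filter_and; apply Hvisits. }
    destruct (large_pole_continuous (Hw k) v Hneq ltac:(lra)) as [Hdef Hf].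
    exists (fin f0 v + c (S k))%C. apply Fit_continuous_S; assumption. }
  exists z. intros k. destruct (Hcont k) as [v Hv]. exists v.
  split; [apply Hv|]. exact (Fit_limit_in_disc u w z k v Hv Hz (Hvisits k)).
Qed.

Lemma preimage_contraction a b u y n : pole a -> pole b -> 0 < Cmod (u - a) <= del ->
  Cmod b / 2 <= Cmod (fin f0 u) -> Cmod (y - (fin f0 u + c n)) <= 1 ->
  exists x, f0 x <> None /\ (fin f0 x + c n)%C = y /\
    Cmod (x - u) <= / 2 * Cmod (y - (fin f0 u + c n)).
Proof.
  intros Ha Hb Hu Hbig Hy.
  pose proof (large_pole_polar Ha) as Hpolar.
  destruct (large_pole_bounds (proj1 del_bounds) Hb) as [_ [_ Hlift]].
  pose proof (large_pole_constant Ha) as HK.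
  pose proof (lift_const_pos K m ltac:(lra)) as HQ.
  assert (Hdist : Cmod (fin f0 u - (y - c n)) = Cmod (y - (fin f0 u + c n))).
  { rewrite Cmod_minus_sym. f_equal. ring. }
  rewrite <- Hdist in *. set (D := Cmod (fin f0 u - (y - c n))) in *.
  assert (HD : 0 <= D) by apply Cmod_ge_0.
  destruct (polar_lift Hpolar u (y - c n)%C) as [x [Hx [Hval Hshort]]]; try lra.
  { fold D. nra. }
  fold D in Hshort.
  pose proof (Cmod_minus_triangle u x a) as Hfar. rewrite (Cmod_minus_sym u x) in Hfar.
  pose proof (Cmod_minus_triangle x u a) as Hnear.
  exists x. split; [|split].
  - apply (large_pole_isolated Ha). lra.
  - rewrite Hval. ring.
  - assert (Hright : lift_const K m * Cmod (u - a) * D <= lift_const K m * 1 * D).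
    { apply Rmult_le_compat_r; [exact HD|]. apply Rmult_le_compat_l; lra. }
    assert (Hleft : 2 * lift_const K m * Cmod (x - u) <= Cmod (fin f0 u) * Cmod (x - u)).
    { apply Rmult_le_compat_r; lra. }
    apply Rmult_le_reg_l with (2 * lift_const K m); lra.
Qed.

Lemma itinerary_pullback w z n v y : pole_sequence w -> itinerary f0 c del w z ->
  Fit f0 c n z = Some v -> Cmod (y - v) <= 1 ->
  exists x, Fit f0 c n x = Some y /\ Cmod (x - z) <= (/ 2) ^ n * Cmod (y - v).
Proof.
  intros Hw Hz. revert v y. induction n as [|n IH]; intros v y Ev Hy.
  - injection Ev as <-. exists y. split; [reflexivity|]. simpl. lra.
  - destruct (Fit_S_inv _ _ _ _ _ Ev) as [u [Eu [_ ->]]].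
    destruct (visits_value_bounds w n z u (Hw n) (Hw (S n)) (Hz n) (Hz (S n)) Eu)
      as [Hu [Hbig _]].
    destruct (preimage_contraction (w n) (w (S n)) u y (S n) (Hw n) (Hw (S n)) Hu Hbig Hy)
      as [x [Hdef [Hval Hxu]]].
    destruct (IH u x Eu) as [x0 [Ex0 Hx0]]; [lra|].
    exists x0. split.
    + rewrite (Fit_S f0 c n x0 x Ex0 Hdef), Hval. reflexivity.
    + eapply Rle_trans; [exact Hx0|]. simpl.
      assert (0 < (/ 2) ^ n) by (apply pow_lt; lra). nra.
Qed.

(* Pulling back the pole [w n] along the orbit gives prepoles which converge to [z]. *)
Lemma itinerary_julia w z : pole_sequence w -> itinerary f0 c del w z -> julia f0 c z.
Proof.
  intros Hw Hz [rad [Hrad [Hdef _]]].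
  destruct (pow_small (/ 2) rad ltac:(lra) Hrad) as [n Hn].
  assert (Hpow : 0 < (/ 2) ^ n) by (apply pow_lt; lra).
  destruct (Hz n) as [v [Ev Hv]]. rewrite Cmod_minus_sym in Hv.
  destruct (itinerary_pullback w z n v (w n) Hw Hz Ev ltac:(lra)) as [x [Ex Hx]].
  apply (Hdef (S n) x).
  - unfold ballC. nra.
  - simpl. rewrite Ex, (large_pole_is_pole (Hw n)). reflexivity.
Qed.

Lemma itinerary_escaping w z : pole_sequence w -> itinerary f0 c del w z ->
  (forall B, eventually (fun n => B <= Cmod (w n))) -> escaping f0 c z.
Proof.
  intros Hw Hz Hinf. split; [|split].
  - exact (itinerary_julia w z Hw Hz).
  - intros n Hnone. destruct (Hz n) as [v [Ev _]]. congruence.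
  - intros B. destruct (Hinf (B + 2)) as [N HN]. exists N. intros n Hn.
    specialize (HN n Hn). destruct (Hz n) as [v [Ev Hv]].
    rewrite (fin_Some _ _ _ Ev). pose proof (Cmod_minus_ge (w n) v) as Htri.
    rewrite Cmod_minus_sym in Htri. lra.
Qed.

(* The factors [|w k|^(1 + 1/m)] of the successive Lipschitz constants are shifted by one
   step, whence the final factor [B^(1 + 1/m)]. *)
Lemma itinerary_expansion w w' z z' n B v v' : pole_sequence w -> pole_sequence w' ->
  itinerary f0 c del w z -> itinerary f0 c del w' z' -> prefix w n = prefix w' n ->
  Cmod (w n) <= B -> Cmod (w' n) <= B ->
  Fit f0 c n z = Some v -> Fit f0 c n z' = Some v' ->
  Cmod (v - v') <=
    Rpower B (1 + / INR m) * lprod (expansion K m beta) (prefix w n) * Cmod (z - z').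
Proof.
  intros Hw Hw' Hz Hz'. revert B v v'.
  assert (HM : 0 < / INR m).
  { apply Rinv_0_lt_compat, lt_0_INR, (large_pole_order (Hw O)). }
  induction n as [|n IH]; intros B v v' Hprefix HB HB' Ev Ev'.
  - injection Ev as <-. injection Ev' as <-. pose proof (large_pole_ge_4 _ (Hw O)).
    assert (1 <= Rpower B (1 + / INR m)) by (apply Rpower_ge_1; lra).
    unfold lprod; simpl. pose proof (Cmod_ge_0 (z - z')). nra.
  - injection Hprefix as Hwn Hprefix.
    destruct (Fit_S_inv _ _ _ _ _ Ev) as [u [Eu [_ ->]]].
    destruct (Fit_S_inv _ _ _ _ _ Ev') as [u' [Eu' [_ ->]]].
    destruct (visits_value_bounds w n z u (Hw n) (Hw (S n)) (Hz n) (Hz (S n)) Eu)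
      as [Hu [_ Hfu]].
    destruct (visits_value_bounds w' n z' u' (Hw' n) (Hw' (S n)) (Hz' n) (Hz' (S n)) Eu')
      as [Hu' [_ Hfu']].
    rewrite <- Hwn in Hu'. pose proof (large_pole_ge_4 _ (Hw (S n))).
    specialize (IH (Cmod (w n)) u u' Hprefix (Rle_refl _) ltac:(rewrite Hwn; lra) Eu Eu').
    replace (fin f0 u + c (S n) - (fin f0 u' + c (S n)))%C
      with (fin f0 u - fin f0 u')%C by ring.
    eapply Rle_trans.
    { apply (large_pole_lipschitz (Hw n) B u' u); lra. }
    pose proof (lip_const_ge_1 K m (large_pole_order (Hw n))
      (large_pole_constant (Hw n))) as Hlip.
    eapply Rle_trans; [apply Rmult_le_compat_l; [|exact IH]|].
    + apply Rmult_le_pos; [apply Rmult_le_pos; [lra|]|]; apply Rlt_le, exp_pos.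
    + apply Req_le. unfold lprod; simpl. unfold expansion at 2, expansion_exponent.
      rewrite (Rpower_plus (1 + / INR m) (beta / INR m)). ring.
Qed.

Lemma itinerary_separation w w' z z' n B : pole_sequence w -> pole_sequence w' ->
  itinerary f0 c del w z -> itinerary f0 c del w' z' -> prefix w n = prefix w' n ->
  Cmod (w n) <= B -> Cmod (w' n) <= B -> 4 * del <= Cmod (w n - w' n) ->
  del <= Rpower B (1 + / INR m) * lprod (expansion K m beta) (prefix w n) * Cmod (z - z').
Proof.
  intros Hw Hw' Hz Hz' Hprefix HB HB' Hapart.
  destruct (Hz n) as [v [Ev Hv]]. destruct (Hz' n) as [v' [Ev' Hv']].
  apply Rle_trans with (Cmod (v - v')).
  - pose proof (Cmod_minus_triangle (w n) v (w' n)) as Htri.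
    rewrite (Cmod_minus_sym (w n) v) in Htri.
    pose proof (Cmod_minus_triangle v v' (w' n)). lra.
  - apply (itinerary_expansion w w'); assumption.
Qed.

End Orbits.

(** * Choice of the finite sets of poles *)

Lemma divergence_outside_list (f : C -> Chat) (k : nat) (t B : R) (L : list C) :
  ~ pole_series_cv f k t ->
  exists T, NoDup T /\ (forall a, In a T -> pole_mult f a k /\ ~ In a L) /\
    B <= lsum (fun a => Rpower (Cmod a) (- t)) T.
Proof.
  intros Hdiv. set (w := fun a : C => Rpower (Cmod a) (- t)).
  apply NNPP. intros Hnone. apply Hdiv. exists (B + lsum w L).
  intros l Hnodup Hl. change (lsum w l <= B + lsum w L).
  rewrite Forall_forall in Hl.
  set (inL := fun a => if excluded_middle_informative (In a L) then true else false).
  assert (HinL : forall a, inL a = true <-> In a L).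
  { intros a. unfold inL.
    destruct excluded_middle_informative; split; tauto || discriminate. }
  rewrite (lsum_filter w inL l), Rplus_comm. apply Rplus_le_compat.
  - apply Rnot_lt_le. intros Hlt. apply Hnone.
    exists (filter (fun a => negb (inL a)) l). split; [apply NoDup_filter, Hnodup|].
    split; [|apply Rlt_le, Hlt]. intros a Ha. apply filter_In in Ha.
    destruct Ha as [Ha Hout]. split; [apply (Hl a Ha)|].
    rewrite <- HinL. destruct (inL a); discriminate.
  - apply lsum_incl; [intros a; apply Rlt_le, exp_pos|apply NoDup_filter, Hnodup|].
    intros a Ha. apply filter_In in Ha. apply HinL, Ha.
Qed.

Lemma slow_schedule (D g : nat -> R) :
  (forall k, 0 < g k <= g (S k)) -> is_lim_seq g p_infty ->
  exists (j : nat -> nat) (D0 : R), 0 < D0 /\ (forall k, D (j k) <= D0 * g k) /\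
    forall J, eventually (fun k => (J <= j k)%nat).
Proof.
  intros Hg Hlim.
  set (j := fix j k := match k with
    | O => O
    | S i => if Rle_dec (D (S (j i))) (g (S i)) then S (j i) else j i end).
  assert (Hmono : forall k k', (k <= k')%nat -> (j k <= j k')%nat).
  { intros k k' Hk. induction Hk as [|k' Hk IH]; [lia|]. simpl. destruct Rle_dec; lia. }
  set (D0 := Rmax 1 (D O / g O)). pose proof (Rmax_l 1 (D O / g O)) as HD0. fold D0 in HD0.
  exists j, D0. split; [lra|]. split.
  - induction k as [|k IH].
    + apply Rle_div_l; [apply Hg|apply Rmax_r].
    + destruct (Hg k) as [Hpos Hincr].
      simpl. destruct Rle_dec as [Hle|Hgt]; [nra|].
      eapply Rle_trans; [exact IH|]. apply Rmult_le_compat_l; lra.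
  - induction J as [|J [N HN]]; [exists O; intros; lia|].
    apply is_lim_seq_spec in Hlim. destruct (Hlim (D (S J))) as [N' HN'].
    set (k0 := Nat.max N N'). exists (S k0). intros k Hk.
    apply Nat.le_trans with (j (S k0)); [|apply Hmono, Hk].
    pose proof (HN k0 ltac:(lia)) as HJ.
    destruct (Nat.eq_dec (j k0) J) as [Heq|Hneq].
    + simpl. rewrite Heq. destruct Rle_dec as [_|Hgt]; [lia|].
      destruct Hgt. apply Rlt_le, HN'. lia.
    + pose proof (Hmono k0 (S k0) ltac:(lia)). lia.
Qed.

Lemma list_bound {A : Type} (g : A -> R) (l : list A) :
  exists B, 0 < B /\ forall a, In a l -> g a <= B.
Proof.
  induction l as [|b l [B [HB Hl]]].
  - exists 1. split; [lra|]. intros a [].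
  - pose proof (Rmax_l B (g b)). exists (Rmax B (g b)). split; [lra|].
    intros a [<-|Ha]; [apply Rmax_r|]. specialize (Hl a Ha). lra.
Qed.

Lemma lprod_Rpower_half {A : Type} (g : A -> R) (s : R) (l : list A) :
  (forall a, 0 < g a) ->
  lprod (fun a => Rpower (g a) (- s) / 2) l = Rpower (lprod g l) (- s) * (/ 2) ^ length l.
Proof.
  intros Hg. induction l as [|a l IH].
  - unfold lprod, Rpower. simpl. rewrite ln_1, Rmult_0_r, exp_0. ring.
  - change (Rpower (g a) (- s) / 2 * lprod (fun b => Rpower (g b) (- s) / 2) l =
      Rpower (g a * lprod g l) (- s) * (/ 2 * (/ 2) ^ length l)).
    rewrite IH, <- Rpower_mult_distr by (try apply lprod_pos; apply Hg). field.
Qed.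

Lemma lprod_le_pow {A : Type} (w : A -> R) (q : R) (l : list A) :
  (forall a, 0 < w a) -> (forall a, In a l -> w a <= q) -> lprod w l <= q ^ length l.
Proof.
  intros Hw. induction l as [|a l IH]; intros Hq; [apply Rle_refl|].
  change (w a * lprod w l <= q * q ^ length l). apply Rmult_le_compat.
  - apply Rlt_le, Hw.
  - apply Rlt_le, lprod_pos, Hw.
  - apply Hq. left. reflexivity.
  - apply IH. intros b Hb. apply Hq. right. exact Hb.
Qed.

Lemma In_prefix {A : Type} (x : nat -> A) (n : nat) (a : A) :
  In a (prefix x n) -> exists k, a = x k.
Proof.
  induction n as [|n IH]; simpl; [intros []|]. intros [<-|Ha]; [exists n|]; auto.
Qed.

(** * The dimension of the escaping set *)

Section EscapingSet.
Context (f0 : C -> Chat) (c : nat -> C) (m : nat) (K beta del s : R) (exceptions : list C).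
Hypothesis m_pos : (1 <= m)%nat.
Hypothesis K_ge_1 : 1 <= K.
Hypothesis beta_nonneg : 0 <= beta.
Hypothesis s_nonneg : 0 <= s.
Hypothesis del_bounds : 0 < del <= 1.
Hypothesis c_small : forall n, Cmod (c n) < del.
Hypothesis poles_separated : forall a b,
  is_pole f0 a -> is_pole f0 b -> a <> b -> 4 * del <= Cmod (a - b).
Hypothesis almost_all_large : forall a,
  pole_mult f0 a m -> ~ In a exceptions -> large_pole f0 m K beta del a.
Hypothesis poles_diverge : ~ pole_series_cv f0 m (expansion_exponent m beta * s).

Notation pole := (large_pole f0 m K beta del).

Definition pole_weight (a : C) : R := Rpower (expansion K m beta a) (- s) / 2.

Lemma expansion_pos a : 0 < expansion K m beta a.
Proof.
  apply Rmult_lt_0_compat; [|apply exp_pos].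
  pose proof (lip_const_ge_1 K m m_pos K_ge_1). lra.
Qed.

Lemma pole_weight_pos a : 0 < pole_weight a.
Proof. apply Rdiv_lt_0_compat; [apply exp_pos|lra]. Qed.

Lemma pole_weight_le_half a : pole a -> pole_weight a <= / 2.
Proof.
  intros Ha. pose proof (large_pole_ge_4 del_bounds a Ha) as Hsize.
  pose proof (lip_const_ge_1 K m m_pos K_ge_1) as Hlip.
  assert (HM : 0 < / INR m) by (apply Rinv_0_lt_compat, lt_0_INR, m_pos).
  assert (Hpow : 1 <= Rpower (Cmod a) (expansion_exponent m beta)).
  { apply Rpower_ge_1; [lra|]. unfold expansion_exponent, Rdiv. nra. }
  assert (Hexp : 1 <= Rpower (expansion K m beta a) s).
  { apply Rpower_ge_1; [unfold expansion; nra|exact s_nonneg]. }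
  unfold pole_weight. rewrite Rpower_Ropp.
  assert (/ Rpower (expansion K m beta a) s <= / 1) by (apply Rinv_le_contravar; lra).
  lra.
Qed.

Lemma pole_weight_Rpower a : pole_weight a =
  / (2 * Rpower (lip_const K m) s) *
  Rpower (Cmod a) (- (expansion_exponent m beta * s)).
Proof.
  pose proof (lip_const_ge_1 K m m_pos K_ge_1) as Hlip.
  unfold pole_weight, expansion.
  rewrite <- Rpower_mult_distr by (try apply exp_pos; lra).
  rewrite Rpower_mult, (Rpower_Ropp (lip_const K m)), Ropp_mult_distr_r.
  field. apply Rgt_not_eq, exp_pos.
Qed.

Lemma pole_level_exists B : exists T, NoDup T /\
  (forall a, In a T -> pole a /\ B <= Cmod a) /\ 1 <= lsum pole_weight T.
Proof.
  destruct (separated_bounded_finite (is_pole f0) (4 * del) B) as [near Hnear];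
    [lra|exact poles_separated|].
  set (M := 2 * Rpower (lip_const K m) s).
  assert (HM : 0 < M) by (apply Rmult_lt_0_compat; [lra|apply exp_pos]).
  destruct (divergence_outside_list f0 m _ M (exceptions ++ near) poles_diverge)
    as [T [Hnodup [HT Hsum]]].
  exists T. split; [exact Hnodup|]. split.
  - intros a Ha. destruct (HT a Ha) as [Hmult Hout]. rewrite in_app_iff in Hout. split.
    + apply almost_all_large; tauto.
    + apply Rlt_le, Rnot_le_lt. intros Hle. apply Hout. right.
      apply Hnear; [apply Hmult|exact Hle].
  - apply Rle_trans with
      (lsum (fun a => / M * Rpower (Cmod a) (- (expansion_exponent m beta * s))) T).
    + rewrite lsum_scal. apply (Rmult_le_compat_l (/ M)) in Hsum.
      * rewrite Rinv_l in Hsum by lra. exact Hsum.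
      * apply Rlt_le, Rinv_0_lt_compat, HM.
    + apply lsum_le. intros a _. apply Req_le. symmetry. apply pole_weight_Rpower.
Qed.

Lemma pole_word_weight_vanishes x eps : (forall k, pole (x k)) -> 0 < eps ->
  exists n, lprod pole_weight (prefix x n) <= eps.
Proof.
  intros Hx Heps.
  destruct (pow_small (/ 2) eps ltac:(lra) Heps) as [n Hn].
  exists n. apply Rle_trans with ((/ 2) ^ length (prefix x n)).
  - apply lprod_le_pow; [exact pole_weight_pos|]. intros a Ha.
    destruct (In_prefix _ _ _ Ha) as [k ->]. apply pole_weight_le_half, Hx.
  - rewrite prefix_length. lra.
Qed.

Lemma pole_word_weight_le x y n z z' r B D0 :
  (forall k, pole (x k)) -> (forall k, pole (y k)) ->
  itinerary f0 c del x z -> itinerary f0 c del y z' ->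
  prefix y n = prefix x n -> y n <> x n -> Cmod (x n) <= B -> Cmod (y n) <= B ->
  Rpower B ((1 + / INR m) * s) <= D0 * 2 ^ n -> 0 < r -> Cmod (z - z') <= r ->
  lprod pole_weight (prefix x n) <= D0 * Rpower del (- s) * Rpower r s.
Proof.
  intros Hx Hy Hz Hz' Hprefix Hneq HxB HyB HB Hr Hdist.
  set (W := lprod (expansion K m beta) (prefix x n)).
  assert (HW : 0 < W) by (apply lprod_pos, expansion_pos).
  set (b := Rpower B (1 + / INR m)). assert (Hb : 0 < b) by apply exp_pos.
  assert (HbW : 0 < b * W) by (apply Rmult_lt_0_compat; assumption).
  assert (Hsep : del <= b * W * r).
  { apply Rle_trans with (b * W * Cmod (z - z')); [|apply Rmult_le_compat_l; lra].
    apply (itinerary_separation del_bounds c_small x y z z' n B Hx Hy Hz Hz'); auto.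
    apply poles_separated; auto; [apply (large_pole_is_pole (Hx n))|].
    apply (large_pole_is_pole (Hy n)). }
  assert (Hpow : Rpower del s <= D0 * 2 ^ n * Rpower W s * Rpower r s).
  { eapply Rle_trans; [apply Rle_Rpower_l; [exact s_nonneg|]|].
    { split; [apply del_bounds|exact Hsep]. }
    rewrite <- !Rpower_mult_distr by assumption. unfold b. rewrite Rpower_mult.
    apply Rmult_le_compat_r; [apply Rlt_le, exp_pos|].
    apply Rmult_le_compat_r; [apply Rlt_le, exp_pos|exact HB]. }
  unfold pole_weight. rewrite lprod_Rpower_half by exact expansion_pos.
  fold W. rewrite prefix_length, !Rpower_Ropp, pow_inv.
  pose proof (exp_pos (s * ln W)) as HWs. change (0 < Rpower W s) in HWs.
  pose proof (exp_pos (s * ln del)) as Hdels. change (0 < Rpower del s) in Hdels.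
  assert (Htwo : 0 < 2 ^ n) by (apply pow_lt; lra).
  apply Rmult_le_reg_r with (Rpower W s * Rpower del s * 2 ^ n);
    [repeat apply Rmult_lt_0_compat; assumption|].
  replace (/ Rpower W s * / 2 ^ n * (Rpower W s * Rpower del s * 2 ^ n))
    with (Rpower del s) by (field; lra).
  replace (D0 * / Rpower del s * Rpower r s * (Rpower W s * Rpower del s * 2 ^ n))
    with (D0 * 2 ^ n * Rpower W s * Rpower r s) by (field; lra).
  exact Hpow.
Qed.

Lemma pole_schedule_exists : exists (T : nat -> list C) (Bd : nat -> R) (D0 : R),
  0 <= D0 /\ (forall n, NoDup (T n)) /\ (forall n, 1 <= lsum pole_weight (T n)) /\
  (forall n a, In a (T n) -> pole a /\ Cmod a <= Bd n) /\
  (forall n, Rpower (Bd n) ((1 + / INR m) * s) <= D0 * 2 ^ n) /\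
  (forall B, eventually (fun n => forall a, In a (T n) -> B <= Cmod a)).
Proof.
  destruct (functional_choice _ (fun j => pole_level_exists (INR j))) as [level Hlevel].
  destruct (functional_choice _ (fun j => list_bound Cmod (level j))) as [bound Hbound].
  destruct (slow_schedule (fun j => Rpower (bound j) ((1 + / INR m) * s)) (pow 2))
    as [j [D0 [HD0 [Hslow Hj]]]].
  { intros k. assert (0 < 2 ^ k) by (apply pow_lt; lra). simpl. lra. }
  { apply is_lim_seq_geom_p. lra. }
  exists (fun n => level (j n)), (fun n => bound (j n)), D0.
  split; [lra|]. split; [intros n; apply Hlevel|]. split; [intros n; apply Hlevel|].
  split; [|split; [exact Hslow|]].
  - intros n a Ha. split; [apply (Hlevel (j n)), Ha|apply (Hbound (j n)), Ha].
  - intros B. destruct (INR_unbounded B) as [J HJ]. generalize (Hj J).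
    apply filter_imp. intros n Hn a Ha. apply le_INR in Hn.
    destruct (Hlevel (j n)) as [_ [Hlarge _]]. destruct (Hlarge a Ha). lra.
Qed.

Lemma escaping_measure_neq_0 : hausdorff_measure s (escaping f0 c) <> Finite 0.
Proof.
  destruct pole_schedule_exists as [T [Bd [D0 [HD0 [Hnodup [Hsum [HT [Hslow Hinf]]]]]]]].
  assert (Hpoles : forall x, branch T x -> forall k, pole (x k)).
  { intros x Hx k. apply (HT k), Hx. }
  apply (hausdorff_measure_neq_0 T pole_weight (itinerary f0 c del) _ s
    (D0 * Rpower del (- s))).
  - exact pole_weight_pos.
  - exact Hnodup.
  - exact Hsum.
  - intros x eps Hx. apply pole_word_weight_vanishes, Hpoles, Hx.
  - intros x Hx.
    destruct (itinerary_exists del_bounds c_small x beta_nonneg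
      (Hpoles x Hx)) as [z Hz].
    exists z. split; [|exact Hz].
    apply (itinerary_escaping del_bounds c_small x z (Hpoles x Hx) Hz).
    intros B. generalize (Hinf B). apply filter_imp. intros n Hn. apply Hn, Hx.
  - intros x y n z z' r Hx Hy Hprefix Hneq Hz Hz' Hr Hdist.
    apply (pole_word_weight_le x y n z z' r (Bd n) D0); auto;
      [apply (HT n), Hx|apply (HT n), Hy].
Qed.

End EscapingSet.

Lemma disjoint_discs_separated (a b : C) (r : R) : 0 < r ->
  (forall z, ~ (ballC a r z /\ ballC b r z)) -> r <= Cmod (a - b).
Proof.
  intros Hr Hdisj. apply Rnot_lt_le. intros Hlt. apply (Hdisj a).
  unfold ballC. rewrite Cmod_minus_diag. auto.
Qed.

Lemma far_pole_large (f0 : C -> Chat) (a : C) (m : nat) (K beta del r : R) :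
  meromorphic f0 -> 1 <= K -> 4 * del <= r ->
  (forall b, is_pole f0 b -> a <> b -> r <= Cmod (a - b)) ->
  pole_mult f0 a m -> pole_estimates f0 a m K beta r ->
  pole_threshold K m del <= Cmod a -> large_pole f0 m K beta del a.
Proof.
  intros Hmero HK Hdel Hsep Hmult Hest Hsize.
  assert (Hdef : forall z, 0 < Cmod (z - a) < 4 * del -> f0 z <> None).
  { intros z Hz Hpole. rewrite Cmod_minus_sym in Hz.
    specialize (Hsep z Hpole (proj2 (Cmod_minus_gt_0 a z) (proj1 Hz))). lra. }
  constructor; [apply Hmult| |exact Hdef|exact Hsize].
  apply pole_estimates_polar; auto. intros z Hz. apply Hest. lra.
Qed.

Lemma almost_all_poles_large (f0 : C -> Chat) (m : nat) (K beta del r : R)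
  (exceptions : list C) :
  meromorphic f0 -> 1 <= K -> 0 < r -> 4 * del <= r ->
  (forall a b, is_pole f0 a -> is_pole f0 b -> a <> b -> r <= Cmod (a - b)) ->
  (forall a, pole_mult f0 a m -> ~ In a exceptions -> pole_estimates f0 a m K beta r) ->
  exists L, forall a, pole_mult f0 a m -> ~ In a L -> large_pole f0 m K beta del a.
Proof.
  intros Hmero HK Hr Hdel Hsep Hest.
  destruct (separated_bounded_finite (is_pole f0) r (pole_threshold K m del) Hr Hsep)
    as [near Hnear].
  exists (exceptions ++ near). intros a Hmult Hout. rewrite in_app_iff in Hout.
  pose proof (proj1 Hmult) as Ha.
  apply (far_pole_large f0 a m K beta del r); auto.
  apply Rlt_le, Rnot_le_lt. auto.
Qed.

Lemma expansion_exponent_lt (m : nat) (beta s rho : R) : (1 <= m)%nat -> 0 <= beta ->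
  s < rho * INR m / (beta + INR m + 1) -> expansion_exponent m beta * s < rho.
Proof.
  intros Hm Hbeta Hlt. assert (HM : 0 < INR m) by (apply lt_0_INR, Hm).
  apply Rlt_div_r in Hlt; [|lra]. apply Rmult_lt_reg_r with (INR m); [exact HM|].
  unfold expansion_exponent.
  replace ((1 + / INR m + beta / INR m) * s * INR m)
    with (s * (beta + INR m + 1)) by (field; lra).
  exact Hlt.
Qed.

Theorem theorem5p3 (f0 : C -> Chat) (rho : R)
  (Pstar : C -> Prop) (Rstar Rdag : R) (M : nat) (beta : R) (Mstar : nat) :
  transcendental_meromorphic f0 ->
  has_order f0 rho -> 0 < rho ->
  (* (KU1) *)
  ~ asymptotic_value_inf f0 ->
  (* (KU2) *)
  (forall a, Pstar a -> is_pole f0 a) ->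
  (exists l : list C, forall a, is_pole f0 a -> ~ Pstar a -> In a l) ->
  0 < Rstar ->
  (forall a, Pstar a -> exists eta, 0 < eta /\
     forall w, sing f0 w -> 2 * Rstar + eta <= Cmod (Cminus w a)) ->
  (* (KU3) *)
  0 < Rdag ->
  (forall a1 a2, is_pole f0 a1 -> is_pole f0 a2 -> a1 <> a2 ->
     forall z, ~ (ballC a1 Rdag z /\ ballC a2 Rdag z)) ->
  (* (KU4) *)
  0 <= beta ->
  (exists K, 1 <= K /\ forall a m, Pstar a -> pole_mult f0 a m ->
     (1 <= m <= M)%nat /\
     forall z, 0 < Cmod (Cminus z a) < Rdag ->
       let A := Rpower (Cmod a) (- beta) * Rpower (Cmod (Cminus z a)) (- INR m) in
       / K * A <= Cmod (fin f0 z) <= K * A /\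
       forall d, cderiv (fin f0) z d ->
         / K * (INR m * A / Cmod (Cminus z a)) <= Cmod d <=
         K * (INR m * A / Cmod (Cminus z a))) ->
  is_Mstar f0 rho M Mstar ->
  exists eps, 0 < eps /\
    forall c : nat -> C, (forall n, Cmod (c n) < eps) ->
      Rbar_le (Finite (rho * INR Mstar / (beta + INR Mstar + 1)))
              (hausdorff_dim (escaping f0 c)).
Proof.
  intros [Hmero _] _ _ _ _ [exceptions Hexc] _ _ HRdag Hdisj Hbeta [K [HK HKU4]]
    [[Hm _] [[_ Hdiv] _]].
  set (del := Rmin 1 (Rdag / 4)).
  pose proof (Rmin_l 1 (Rdag / 4) : del <= 1) as Hdel_1.
  pose proof (Rmin_r 1 (Rdag / 4) : del <= Rdag / 4) as Hdel_Rdag.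
  assert (Hdel : 0 < del) by (apply Rmin_pos; lra).
  exists del. split; [exact Hdel|]. intros c Hc.
  assert (Hsep : forall a b, is_pole f0 a -> is_pole f0 b -> a <> b ->
    Rdag <= Cmod (a - b)).
  { intros a b Ha Hb Hab. apply disjoint_discs_separated; auto. }
  destruct (almost_all_poles_large f0 Mstar K beta del Rdag exceptions) as [L HL];
    auto; [lra| |].
  { intros a Hmult Hout. refine (proj2 (HKU4 a Mstar _ Hmult)).
    apply NNPP. intros Hnot. exact (Hout (Hexc a (proj1 Hmult) Hnot)). }
  apply hausdorff_dim_ge. intros s Hs Hlt.
  apply (escaping_measure_neq_0 f0 c Mstar K beta del s L); auto.
  - intros a b Ha Hb Hab. specialize (Hsep a b Ha Hb Hab). lra.
  - apply Hdiv, expansion_exponent_lt; assumption.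
Qed.
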